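(* Let $0\le\alpha\le\beta\le 1$ and $K(x,y)=x^\alpha y^\beta+x^\beta y^\alpha$ for $(x,y)\in(0,\infty)^2$. Let $b$ be a daughter distribution function such that, for all $(x,y)\in(0,\infty)^2$, $\int_0^{x+y} z\,b(z,x,y)\,dz=x+y$, $b(z,x,y)=0$ for $z>x+y$, and $\int_0^{x+y}b(z,x,y)\,dz\le\beta_0$ for some constant $\beta_0>2$ independent of $(x,y)$. Let $f^{in}\in X_0\cap X_1^+$ and $T>0$. Then there is at most one weak solution $f$ on $[0,T)$ to the collision-induced breakage equation with initial condition $f^{in}$ such that $$M_{1+\beta}(f)\in L^1(0,t)\quad\text{for each } t\in(0,T).$$
   Context: Functions are measurable. For $m\in\mathbb R$, $X_m:=L^1((0,\infty),x^m dx)$ with norm $\|h\|_{X_m}=\int_0^\infty x^m|h(x)|\,dx$, $M_m(h):=\int_0^\infty x^m h(x)\,dx$, and $X_m^+$ is the cone of (a.e.) non-negative elements of $X_m$; $X_{0,w}$ is $X_0=L^1(0,\infty)$ with its weak topology. $M_m(f)$ denotes the function $t\mapsto M_m(f(t))$. A daughter distribution function is a non-negative measurable function $b$ on $(0,\infty)^3$. The collision-induced breakage equation with collision kernel $K$, daughter distribution function $b$ and initial condition $f^{in}$ is $\partial_t f=\mathcal Bf$, $f(0)=f^{in}$, with $$\mathcal B f(x)=\frac12\int_x^\infty\int_0^y b(x,y-z,z)K(y-z,z)f(y-z)f(z)\,dz\,dy-\int_0^\infty K(x,y)f(x)f(y)\,dy.$$ Weak solution: for $T\in(0,\infty]$,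 a weak solution on $[0,T)$ is a non-negative $f\in C([0,T),X_{0,w})\cap L^\infty((0,T),X_1^+)$ such that $(s,x,y)\mapsto K(x,y)f(s,x)f(s,y)\in L^1((0,t)\times(0,\infty)^2)$ and $$\int_0^\infty\phi(x)(f(t,x)-f^{in}(x))\,dx=\frac12\int_0^t\int_0^\infty\int_0^\infty\zeta_\phi(x,y)K(x,y)f(s,x)f(s,y)\,dy\,dx\,ds$$ for all $t\in(0,T)$ and $\phi\in L^\infty(0,\infty)$, where $\zeta_\phi(x,y):=\int_0^{x+y}\phi(z)b(z,x,y)\,dz-\phi(x)-\phi(y)$. *)

(* Defs.v *)
From mathcomp Require Import all_boot all_order all_algebra.
From mathcomp Require Import all_classical all_reals all_analysis.
Import Order.TTheory GRing.Theory Num.Theory.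
Import numFieldNormedType.Exports.

Set Implicit Arguments.
Unset Strict Implicit.
Unset Printing Implicit Defensive.

Local Open Scope classical_set_scope.
Local Open Scope ring_scope.

(* Elements of the spaces of (classes of) functions on (0,oo) are represented
   by functions R -> R, of which only the values on ]0,+oo[ matter; equality in
   these spaces is equality almost everywhere on ]0,+oo[.  Measurability is
   Borel measurability. *)

Definition halfline (R : realType) : set R := `]0, +oo[.
Arguments halfline : clear implicits.

Section FunctionSpaces.
Context {R : realType}.
Local Notation mu := (@lebesgue_measure R).
Local Notation Rpos := (halfline R).

Definition ae_nonneg (h : R -> R) : Prop :=
  {ae mu, forall x, Rpos x -> 0 <= h x}.

(* X_m = L^1((0,oo), x^m dx) *)
Definition X (m : R) (h : R -> R) : Prop :=
  mu.-integrable Rpos (fun x => (x `^ m * h x)%:E).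

Definition Xplus (m : R) (h : R -> R) : Prop := X m h /\ ae_nonneg h.

Definition Xnorm (m : R) (h : R -> R) : \bar R :=
  (\int[mu]_(x in Rpos) (x `^ m * `|h x|)%:E)%E.

(* Extended-real valued, so that M m h = +oo when h >= 0 is not in X_m. *)
Definition M (m : R) (h : R -> R) : \bar R :=
  (\int[mu]_(x in Rpos) (x `^ m * h x)%:E)%E.

Definition Linfty (phi : R -> R) : Prop :=
  measurable_fun Rpos phi /\
  exists C : R, {ae mu, forall x, Rpos x -> `|phi x| <= C}.

(* [0,T) and (0,T), for T in (0,oo] *)
Definition itv_co (T : \bar R) : set R := [set t | 0 <= t /\ (t%:E < T)%E].
Definition itv_oo (T : \bar R) : set R := [set t | 0 < t /\ (t%:E < T)%E].

(* C([0,T), X_{0,w}); the dual of X_0 = L^1(0,oo) is L^oo(0,oo). *)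
Definition weakly_continuous_X0 (T : \bar R) (f : R -> R -> R) : Prop :=
  (forall t, itv_co T t -> X 0 (f t)) /\
  (forall phi, Linfty phi ->
    {within itv_co T, continuous
       (fun t => \int[mu]_(x in Rpos) (phi x * f t x))}).

Definition simple_into_X (m : R) (u : R -> R -> R) : Prop :=
  exists (n : nat) (A : 'I_n -> set R) (h : 'I_n -> R -> R),
    [/\ forall i, measurable (A i),
        forall i, X m (h i) &
        forall t x, u t x = \sum_(i < n) \1_(A i) t * h i x].

(* Bochner measurability of an X_m-valued function *)
Definition strongly_measurable (m : R) (I : set R) (f : R -> R -> R) : Prop :=
  exists u : nat -> R -> R -> R,
    (forall k, simple_into_X m (u k)) /\
    {ae mu, forall t, I t ->
       (fun k => Xnorm m (fun x => u k t x - f t x)) @ \oo --> 0%E}.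

(* L^oo((0,T), X_m^+) *)
Definition Linfty_Xplus (m : R) (T : \bar R) (f : R -> R -> R) : Prop :=
  [/\ {ae mu, forall t, itv_oo T t -> Xplus m (f t)},
      strongly_measurable m (itv_oo T) f &
      exists C : R, {ae mu, forall t, itv_oo T t -> (Xnorm m (f t) <= C%:E)%E}].

End FunctionSpaces.

Section CollisionInducedBreakage.
Context {R : realType}.
Local Notation mu := (@lebesgue_measure R).
Local Notation Rpos := (halfline R).

(* b z x y is the distribution of fragments of size z produced by a collision
   of particles of sizes x and y. *)
Definition daughter_distribution (b : R -> R -> R -> R) : Prop :=
  measurable_fun (Rpos `*` (Rpos `*` Rpos))
    (fun p : R * (R * R) => b p.1 p.2.1 p.2.2) /\
  (forall z x y, 0 < z -> 0 < x -> 0 < y -> 0 <= b z x y).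

Definition zeta (b : R -> R -> R -> R) (phi : R -> R) (x y : R) : R :=
  \int[mu]_(z in `]0, (x + y)[) (phi z * b z x y) - phi x - phi y.

Record weak_solution (K : R -> R -> R) (b : R -> R -> R -> R) (fin : R -> R)
    (T : \bar R) (f : R -> R -> R) : Prop := WeakSolution {
  ws_nonneg : forall t, itv_co T t -> ae_nonneg (f t);
  ws_continuous : weakly_continuous_X0 T f;
  ws_bounded : Linfty_Xplus 1 T f;
  ws_integrable : forall t, itv_oo T t ->
    (mu \x (mu \x mu))%E.-integrable (`]0, t[ `*` (Rpos `*` Rpos))
      (fun p : R * (R * R) =>
         (K p.2.1 p.2.2 * f p.1 p.2.1 * f p.1 p.2.2)%:E);
  ws_eq : forall t phi, itv_oo T t -> Linfty phi ->
    \int[mu]_(x in Rpos) (phi x * (f t x - fin x)) =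
    2^-1 * \int[mu]_(s in `]0, t[) \int[mu]_(x in Rpos) \int[mu]_(y in Rpos)
             (zeta b phi x y * K x y * f s x * f s y)
}.

Definition sum_kernel (alpha beta x y : R) : R :=
  x `^ alpha * y `^ beta + x `^ beta * y `^ alpha.

End CollisionInducedBreakage.

(* Main.v *)
From HB Require Import structures.
Require Import Defs.
From mathcomp Require Import all_boot all_order all_algebra.
From mathcomp Require Import all_classical all_reals all_analysis.
From mathcomp Require Import measurable_realfun ring lra.
Set Implicit Arguments.
Unset Strict Implicit.
Unset Printing Implicit Defensive.
Import Order.TTheory GRing.Theory Num.Theory.
Import numFieldNormedType.Exports.

Local Open Scope classical_set_scope.
Local Open Scope ring_scope.

(** Let E be the difference and S the sum of two solutions.  Since
    f(x) f(y) - g(x) g(y) = (S(x) E(y) + E(x) S(y)) / 2, testing the equation for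
    E with the sign of E times the weight w(x) = 1 + x formally gives

      d/dt (int w |E|) <= c (int (1 + x^(1+beta)) S) (int w |E|).

    Indeed the daughter distribution turns the weight w into at most
    beta0 + x + y, so that in the term with S(x) E(y) the loss at y leaves a
    factor beta0 + 2 x on |E(y)|: the size y has disappeared, and x K(x,y) is at
    most 2 (1 + x^(1+beta)) (1 + y).  The moment of order 1 + beta of S is
    integrable in time, and the inequality of Gronwall (gronwall_zero) gives
    E = 0.

    Two points need care.  First, test functions are bounded, so w is cut off at
    a size n.  For y > n the loss is missing, but what it leaves is bounded by the
    tail over y > n of the same moment (half_flux), and it vanishes as n goes to
    infinity (tail_cvg0).  Secondly, test functions do not depend on time.  On a
    short interval [r, t] the sign is frozen at time t; this costs at most
    twice |E(t) - E(s)|, whose integral is O(t - s) (lipschitz_L1).  The error on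
    [r, t] is therefore O((t - r)^2) for each n, and it disappears when a fixed
    interval is cut into short ones (le_of_quadratic_increments).

    A weak solution is first replaced by its absolute value, which is equal to it
    almost everywhere at each time: it is jointly measurable in time and size,
    because the collision term is measurable (measurable_abs_ext).  The equation
    becomes an identity between integrals over time and pairs of sizes
    (abs_balance), so that increments, differences and upper bounds are those of
    one integral.  The equality at time 0 follows from the one at positive times
    by weak continuity (uniqueness_initial). *)

(** * Integrals over a time set and pairs of sizes *)

(** The integral of f is at most that of its positive part, which is below g. *)
Lemma le_integral_ge0 (R : realType) d (T : measurableType d)
    (m : {measure set T -> \bar R}) (D : set T) (f g : T -> \bar R) :
  measurable D ->
  measurable_fun D f -> measurable_fun D g ->
  (forall x, D x -> (0 <= g x)%E) -> (forall x, D x -> (f x <= g x)%E) ->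
  (\int[m]_(x in D) f x <= \int[m]_(x in D) g x)%E.
Proof.
move=> mD mf mg g0 fg; rewrite [leLHS]integralE.
apply: (@le_trans _ _ (\int[m]_(x in D) f^\+ x)%E).
  rewrite -[leRHS]sube0 leeB//; exact: integral_ge0.
apply: ge0_le_integral => //.
- by apply: measurable_funepos.
- by move=> x Dx; rewrite funeposE ge_max fg// g0.
Qed.

Lemma integral12_slab {d1 d2} {T1 : measurableType d1} {T2 : measurableType d2}
    {R : realType} (m1 : {sigma_finite_measure set T1 -> \bar R})
    (m2 : {sigma_finite_measure set T2 -> \bar R})
    (D : set T1) (f : T1 * T2 -> \bar R) : measurable D ->
  measurable_fun setT f -> (forall z, (0 <= f z)%E) ->
  (\int[m1 \x m2]_(z in D `*` setT) f z = \int[m1]_(x in D) \int[m2]_y f (x, y))%E.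
Proof.
move=> mD mf f0.
rewrite integral_mkcond fubini_tonelli1//.
- rewrite [RHS]integral_mkcond; apply: eq_integral => x _.
  rewrite /fubini_F /patch.
  case: ifPn => xD.
  + by apply: eq_integral => y _; rewrite ifT// inE; split => //; rewrite inE in xD.
  + apply: integral0_eq => y _; rewrite ifF//; apply/negbTE; apply: contra xD.
    by rewrite !inE => -[].
- apply/(measurable_restrictT _ _).1; first exact: measurableX.
  exact: measurable_funS mf.
- by move=> x; apply: erestrict_ge0.
Qed.

Section Product.
Context {R : realType}.
Local Notation mu := (@lebesgue_measure R).

(** The planar Lebesgue measure under a name of its own, to which a sigma-finite
    structure is attached; it is then a legitimate second factor of a product. *)
Definition leb2 : set (measurableTypeR R * measurableTypeR R) -> \bar R := (mu \x mu)%E.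
HB.instance Definition _ := Measure.on leb2.
Lemma leb2_sigma_finite : sigma_finite setT leb2.
Proof.
exists (fun n => `]-n%:R, n%:R[%classic `*` `]-n%:R, n%:R[%classic).
- rewrite eqEsubset; split=> // -[x y] _ /=.
  exists (Num.truncn (Num.max `|x| `|y|)).+1 => //=.
  have := truncnS_gt (Num.max `|x| `|y|); rewrite gt_max => /andP[xn yn].
  by rewrite !in_itv/= -!ltr_norml.
- move=> n; split; first exact: measurableX.
  have nfin : (mu `](-n%:R)%R, (n%:R)%R[%classic < +oo)%E.
    by rewrite lebesgue_measure_itv/=; case: ifPn => _; rewrite -?EFinB ?ltry.
  rewrite /leb2 product_measure1E//.
  by apply: lte_mul_pinfty => //; rewrite ge0_fin_numE.
Qed.
HB.instance Definition _ := Measure_isSigmaFinite.Build _ _ _ leb2 leb2_sigma_finite.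

Lemma measurable_section {d1 d2 d3} {T1 : measurableType d1} {T2 : measurableType d2}
  {T3 : measurableType d3} (a : T1 * T2 -> T3) (s : T1) :
  measurable_fun setT a -> measurable_fun setT (fun x => a (s, x)).
Proof. by move=> ma; apply: measurableT_comp => //; exact: measurable_pair1. Qed.

Lemma measurable_fun_comp2 {d} {T : measurableType d} (a : R * R -> R)
    (u v : T -> R) :
  measurable_fun setT a -> measurable_fun setT u -> measurable_fun setT v ->
  measurable_fun setT (fun x => a (u x, v x)).
Proof.
by move=> ma m_u m_v; apply: measurableT_comp => //; exact: measurable_fun_pair.
Qed.

Lemma measurable_sgr : measurable_fun setT (@Num.sg R).
Proof.
have -> : @Num.sg R = (fun x => if x < 0 then -1 else if 0 < x then 1 else 0).
  by apply/funext => x; case: ltgtP => [/ltr0_sg|/gtr0_sg|->] //; rewrite sgr0.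
by apply: measurable_fun_ifT => //; last apply: measurable_fun_ifT => //;
  exact: measurable_fun_ltr.
Qed.

Lemma measurable_time : measurable_fun setT (fun q : R * (R * R) => q.1).
Proof. exact: measurable_fst. Qed.

Lemma measurable_size1 : measurable_fun setT (fun q : R * (R * R) => q.2.1).
Proof. exact: (measurableT_comp measurable_fst measurable_snd). Qed.

Lemma measurable_size2 : measurable_fun setT (fun q : R * (R * R) => q.2.2).
Proof. exact: (measurableT_comp measurable_snd measurable_snd). Qed.

Lemma integral_prodM (a c : R -> \bar R) :
  measurable_fun setT a -> measurable_fun setT c ->
  (forall x, (0 <= a x)%E) -> (forall x, (0 <= c x)%E) ->
  (\int[leb2]_p (a p.1 * c p.2) = (\int[mu]_x a x) * \int[mu]_x c x)%E.
Proof.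
move=> ma mc a0 c0.
rewrite (fubini_tonelli1 (m1:=mu) (m2:=mu)); first last.
- by move=> x; exact: mule_ge0.
- apply: emeasurable_funM; apply: measurableT_comp => //.
rewrite /fubini_F /=.
under eq_integral do rewrite ge0_integralZl//.
by rewrite ge0_integralZr//; apply: integral_ge0.
Qed.

Lemma integral_slab_prodM (D : set R) (a c : R * R -> R) : measurable D ->
  measurable_fun setT a -> measurable_fun setT c ->
  (forall x, 0 <= a x) -> (forall x, 0 <= c x) ->
  (\int[mu \x leb2]_(q in D `*` setT)
      (a (q.1, q.2.1) * c (q.1, q.2.2))%:E =
   \int[mu]_(s in D) ((\int[mu]_x (a (s, x))%:E) * \int[mu]_x (c (s, x))%:E))%E.
Proof.
move=> mD ma mc a0 c0.
rewrite integral12_slab//.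
- apply: eq_integral => s _ /=.
  rewrite -integral_prodM//.
  + by apply/measurable_EFinP; apply: measurable_section.
  + by apply/measurable_EFinP; apply: measurable_section.
  + by move=> x; rewrite /= lee_fin.
  + by move=> x; rewrite /= lee_fin.
- apply/measurable_EFinP; apply: measurable_funM.
  + exact: measurable_fun_comp2 ma measurable_time measurable_size1.
  + exact: measurable_fun_comp2 mc measurable_time measurable_size2.
- by move=> z; rewrite lee_fin mulr_ge0.
Qed.

(** At fixed time the two sizes decouple.  Both orders of the factors occur
    because each of the two colliding particles carries the difference E in turn. *)
Lemma integral_slab_symM (D : set R) (a c : R * R -> R) (k : R) :
  measurable D -> measurable_fun setT a -> measurable_fun setT c ->
  (forall x, 0 <= a x) -> (forall x, 0 <= c x) -> 0 <= k ->
  (\int[mu \x leb2]_(q in D `*` setT)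
      (k * (a (q.1, q.2.1) * c (q.1, q.2.2) + c (q.1, q.2.1) * a (q.1, q.2.2)))%:E =
   (2 * k)%:E *
     \int[mu]_(s in D) ((\int[mu]_x (a (s, x))%:E) * \int[mu]_x (c (s, x))%:E))%E.
Proof.
move=> mD ma mc a0 c0 k0.
have mprod (u v : R * R -> R) : measurable_fun setT u -> measurable_fun setT v ->
    measurable_fun setT (fun q : R * (R * R) => (u (q.1, q.2.1) * v (q.1, q.2.2))%:E).
  move=> m_u m_v; apply/measurable_EFinP; apply: measurable_funM.
  - exact: measurable_fun_comp2 m_u measurable_time measurable_size1.
  - exact: measurable_fun_comp2 m_v measurable_time measurable_size2.
have mDT : measurable (D `*` [set: R * R]) by exact: measurableX.
under eq_integral do rewrite EFinM EFinD.
rewrite ge0_integralZl//; first last.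
- by move=> q _; rewrite -EFinD lee_fin addr_ge0// mulr_ge0.
- by apply: measurable_funTS; apply: emeasurable_funD; exact: mprod.
rewrite ge0_integralD//; first last.
- by apply: measurable_funTS; exact: mprod.
- by move=> q _; rewrite lee_fin mulr_ge0.
- by apply: measurable_funTS; exact: mprod.
- by move=> q _; rewrite lee_fin mulr_ge0.
rewrite (integral_slab_prodM mD ma mc a0 c0) (integral_slab_prodM mD mc ma c0 a0).
under [X in (_ * (_ + X))%E]eq_integral do rewrite muleC.
have I0 : (0 <= \int[mu]_(s in D) ((\int[mu]_x (a (s, x))%:E) *
    \int[mu]_x (c (s, x))%:E))%E.
  by apply: integral_ge0 => s _; apply: mule_ge0; apply: integral_ge0 => x _;
    rewrite lee_fin.
by rewrite ge0_muleDr// mulr_natl mulr2n EFinD ge0_muleDl// lee_fin.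
Qed.

Lemma ae_sub (P Q : R -> Prop) : (forall x, P x -> Q x) ->
  {ae mu, forall x, P x} -> {ae mu, forall x, Q x}.
Proof.
by move=> PQ; apply: filterS PQ; exact: (ae_filter_ringOfSetsType mu).
Qed.

Lemma ae_sub2 (P Q S : R -> Prop) : (forall x, P x -> Q x -> S x) ->
  {ae mu, forall x, P x} -> {ae mu, forall x, Q x} -> {ae mu, forall x, S x}.
Proof.
by move=> PQ; apply: filterS2 PQ; exact: (ae_filter_ringOfSetsType mu).
Qed.

Lemma ae_all (P : R -> Prop) : (forall x, P x) -> {ae mu, forall x, P x}.
Proof. by move=> HP; apply: nearW => //; exact: (ae_filter_ringOfSetsType mu). Qed.

End Product.

(** * Real inequalities *)

(** Cutting [0, T] into n + 1 equal steps, the quadratic errors add up to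
    c T^2 / (n + 1). *)
Lemma le_of_quadratic_increments {R : realType} (U V : R -> R) (T c : R) : 0 <= T ->
  (forall r t, 0 <= r -> r <= t -> t <= T ->
     U t - U r <= V t - V r + c * (t - r) ^+ 2) ->
  U T - U 0 <= V T - V 0.
Proof.
move=> T0 H.
have part (n k : nat) : (k <= n.+1)%N ->
    U (k%:R * (T / n.+1%:R)) - U 0 <=
    V (k%:R * (T / n.+1%:R)) - V 0 + k%:R * (c * (T / n.+1%:R) ^+ 2).
  elim: k => [|k IH] kn; first by rewrite !mul0r !subrr addr0.
  have h0 : 0 <= T / n.+1%:R by rewrite divr_ge0.
  have k1 : k%:R * (T / n.+1%:R) <= k.+1%:R * (T / n.+1%:R).
    by rewrite ler_wpM2r// ler_nat.
  have k2 : k.+1%:R * (T / n.+1%:R) <= T.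
    by rewrite mulrCA ler_piMr// ler_pdivrMr ?ltr0n// mul1r ler_nat.
  have := H _ _ (mulr_ge0 (ler0n R k) h0) k1 k2.
  have -> : k.+1%:R * (T / n.+1%:R) - k%:R * (T / n.+1%:R) = T / n.+1%:R.
    by rewrite -natr1 mulrDl mul1r addrC addKr.
  move=> step.
  have := IH (ltnW kn); move: step; set d := T / _.
  rewrite -(natr1 k) [X in _ -> _ -> _ <= _ - _ + X]mulrDl mul1r; lra.
apply/ler_addgt0Pr => e e0.
pose n := Num.truncn (`|c| * T ^+ 2 / e).
have := part n n.+1 (leqnn _); have -> : n.+1%:R * (T / n.+1%:R) = T.
  by rewrite mulrCA mulfV ?mulr1// pnatr_eq0.
move=> /le_trans; apply; rewrite lerD2l.
have -> : n.+1%:R * (c * (T / n.+1%:R) ^+ 2) = c * T ^+ 2 / n.+1%:R.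
  have : n.+1%:R != 0 :> R by rewrite pnatr_eq0.
  by move=> ?; field.
rewrite ler_pdivrMr ?ltr0n//.
apply: (@le_trans _ _ (`|c| * T ^+ 2)); first by rewrite ler_wpM2r ?sqr_ge0 ?ler_norm.
by rewrite [leRHS]mulrC -ler_pdivrMr// ltW// truncnS_gt.
Qed.

(** With h = q this is the uniform integrability behind absolute continuity; with
    h the size variable it makes the tails of a moment vanish. *)
Lemma integral_tail_cvg0 {R : realType} {d} {T : measurableType d}
    (m : {measure set T -> \bar R}) (D : set T) (q h : T -> \bar R) :
  measurable D -> m.-integrable D q -> (forall x, D x -> (0 <= q x)%E) ->
  measurable_fun setT h -> {ae m, forall x, D x -> (h x < +oo)%E} ->
  (\int[m]_(x in D `&` [set x | (n%:R%:E < h x)%E]) q x @[n --> \oo] --> 0)%E.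
Proof.
move=> mD iq q0 mh hfin.
have mq : measurable_fun D q by exact: measurable_int iq.
pose A n := [set x | (n%:R%:E < h x)%E].
have mA n : measurable (A n).
  by rewrite -[A n]setTI; exact: emeasurable_fun_o_infty.
under eq_fun do rewrite integral_mkcondr -/(A _).
have := @dominated_convergence _ _ _ m D mD (fun n => q \_ (A n)) (cst 0%E) q.
case => //.
- move=> n; apply/(measurable_restrict _ _ _).1 => //.
  by apply: measurable_funS mq => //; exact: subIsetl.
- apply: filterS hfin => x hx Dx; have {}hx := hx Dx.
  apply: cvg_near_cst; near=> n.
  rewrite /patch ifF//; apply/negbTE; rewrite notin_setE /A /=; apply/negP; rewrite -leNgt.
  have [hle|h0] := leP (h x) 0%E; first by rewrite (le_trans hle)// lee_fin.
  have /fineK <- : h x \is a fin_num by rewrite ge0_fin_numE// ltW.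
  by rewrite lee_fin; near: n; exact: nbhs_infty_ger.
- apply: nearW => x n Dx; rewrite /patch; case: ifPn => _.
    by rewrite gee0_abs ?q0.
  by rewrite abse0 q0.
- by rewrite integral0_eq.
Unshelve. all: by end_near. Qed.

(** Where q is at most N its integral over A is at most N times the measure of A;
    where q exceeds N its integral is small once N is large. *)
Lemma integral_abs_continuous {R : realType} {d} {T : measurableType d}
    (m : {measure set T -> \bar R}) (D : set T) (q : T -> \bar R) (e : R) :
  measurable D -> measurable_fun setT q -> (forall x, (0 <= q x)%E) ->
  (\int[m]_(x in D) q x < +oo)%E -> 0 < e ->
  exists2 delta : R, 0 < delta & forall A, measurable A -> A `<=` D ->
    (m A <= delta%:E)%E -> (\int[m]_(x in A) q x <= e%:E)%E.
Proof.
move=> mD mq q0 qoo e0.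
have iq : m.-integrable D q.
  apply/integrableP; split; first exact: measurable_funTS.
  by under eq_integral do rewrite gee0_abs//.
have qfin : {ae m, forall x, D x -> (q x < +oo)%E}.
  by apply: filterS (integrable_ae mD iq) => x /[apply]; rewrite ge0_fin_numE.
have := integral_tail_cvg0 mD iq (fun x _ => q0 x) mq qfin.
move=> /fine_cvgP[+ /cvgrPdist_le /(_ (e / 2))].
rewrite divr_gt0// => finN /(_ isT) tailN.
have [N] : exists N : nat, (\int[m]_(x in D `&` [set x | (N%:R%:E < q x)%E]) q x
    <= (e / 2)%:E)%E.
  near \oo => N; exists N.
  have fN : (\int[m]_(x in D `&` [set x | (N%:R%:E < q x)%E]) q x)%E \is a fin_num.
    by near: N.
  rewrite -(fineK fN) lee_fin.
  have : `|0 - fine (\int[m]_(x in D `&` [set x | (N%:R%:E < q x)%E]) q x)%E| <= e / 2.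
    by near: N.
  by rewrite sub0r normrN; apply: le_trans; exact: ler_norm.
set B := [set x | _] => tailN'.
have mB : measurable B by rewrite -[B]setTI; exact: emeasurable_fun_o_infty.
(* N + 1 rather than N, which may be 0 *)
exists (e / 2 / (N.+1%:R)); first by rewrite !divr_gt0.
move=> A mA AD mAd.
have AE : A = (A `&` B) `|` (A `&` ~` B) by rewrite -setIUr setUv setIT.
rewrite [X in (\int[m]_(x in X) q x)%E]AE ge0_integral_setU//; first last.
- by rewrite disj_set2E setIACA setICr setI0.
- exact: measurable_funTS.
- by apply: measurableI => //; exact: measurableC.
- exact: measurableI.
rewrite [e in leRHS]splitr EFinD leeD//.
- apply: le_trans tailN'; apply: ge0_subset_integral => //.
  + exact: measurableI.
  + exact: measurableI.
  + exact: measurable_funTS.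
  + by apply: setSI.
- apply: (@le_trans _ _ (\int[m]_(x in A `&` ~` B) N%:R%:E)%E).
    apply: ge0_le_integral => //.
    + by apply: measurableI => //; exact: measurableC.
    + exact: measurable_funTS.
    + by move=> x [_]; rewrite /B /= => /negP; rewrite -leNgt.
  rewrite integral_cst; last by apply: measurableI => //; exact: measurableC.
  apply: (@le_trans _ _ (N%:R%:E * (e / 2 / N.+1%:R)%:E)%E).
    apply: lee_pmul => //; rewrite ?lee_fin//.
    apply: le_trans mAd; apply: le_measure => //; rewrite ?inE//.
    by apply: measurableI => //; exact: measurableC.
  rewrite -EFinM lee_fin mulrCA ler_piMr ?divr_ge0 ?ltW//.
  by rewrite ltr_pdivrMr// mul1r ltr_nat.
Unshelve. all: by end_near. Qed.

Section Gronwall.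
Context {R : realType}.
Local Notation mu := (@lebesgue_measure R).

(** Since L is only integrable, the time interval is covered by steps of a length
    delta on which L has mass at most 1/2.  If v vanishes before a, then on
    [a, a + delta] each use of the integral inequality halves the bound on v. *)
Lemma gronwall_zero (v L : R -> \bar R) (T B : R) :
  measurable_fun setT v -> measurable_fun setT L ->
  (forall s, (0 <= v s)%E) -> (forall s, (0 <= L s)%E) ->
  (\int[mu]_(s in `]0%R, T[) L s < +oo)%E ->
  {ae mu, forall s : R, 0 < s < T -> (v s <= B%:E)%E} ->
  (forall t, 0 < t < T ->
     (v t <= \int[mu]_(s in `]0%R, t[) (L s * v s))%E) ->
  forall t, 0 < t < T -> v t = 0%E.
Proof.
move=> mv mL v0 L0 Loo vB vle.
have h0 : 0 < 2^-1 :> R by [].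
have [delta delta0 small] :=
  @integral_abs_continuous _ _ _ mu _ L _ (measurable_itv `]0%R, T[) mL L0 Loo h0.
pose C := Num.max B 0.
have C0 : 0 <= C by rewrite le_max lexx orbT.
have step (a : R) : 0 <= a -> (forall t, 0 < t < T -> t < a -> v t = 0%E) ->
    forall t, 0 < t < T -> t < a + delta -> v t = 0%E.
  move=> a0 va.
  (* only the part of ]0, t[ after a contributes, and L has mass 1/2 there *)
  have decay k : {ae mu, forall s : R, 0 < s < T -> s < a + delta ->
      (v s <= (C * 2^-1 ^+ k)%:E)%E} ->
    forall t, 0 < t < T -> t < a + delta -> (v t <= (C * 2^-1 ^+ k.+1)%:E)%E.
    move=> vk t /andP[t0 tT] ta; apply: le_trans (vle t _) _; first by rewrite t0.
    pose A := `]0%R, t[%classic `&` `[a, +oo[%classic.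
    have mA : measurable A by exact: measurableI.
    have c0 : 0 <= C * 2^-1 ^+ k by rewrite mulr_ge0// exprn_ge0.
    apply: (@le_trans _ _ (\int[mu]_(s in A) ((C * 2^-1 ^+ k)%:E * L s))%E).
      rewrite integral_mkcondr; apply: ae_ge0_le_integral => //.
      - by move=> s _; exact: mule_ge0.
      - by apply: measurable_funTS; exact: emeasurable_funM.
      - move=> s _; rewrite /patch; case: ifPn => // _.
        by rewrite mule_ge0// lee_fin.
      - apply: measurable_funTS; apply/(measurable_restrictT _ _).1 => //.
        by apply: measurable_funTS; apply: emeasurable_funM.
      - apply: ae_sub vk => s vs; rewrite /= in_itv/= => /andP[s0 st].
        rewrite /patch; case: ifPn => [_|].
          rewrite muleC lee_wpmul2r// vs ?s0 ?(lt_trans st)//.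
        rewrite notin_setE/= in_itv/= andbT => /negP; rewrite -ltNge => sa.
        by rewrite va ?mule0// s0 (lt_trans st).
    rewrite ge0_integralZl//; last exact: measurable_funTS.
    rewrite exprSr mulrA [leRHS]EFinM lee_wpmul2l//.
    apply: small => //.
      move=> s [] /=; rewrite !in_itv/= => /andP[-> st] _ /=.
      exact: lt_trans st tT.
    apply: (@le_trans _ _ (mu `[a, (a + delta)]%classic)).
      apply: le_measure; rewrite ?inE// => s []/=; rewrite !in_itv/=.
      by rewrite andbT => /andP[_ st] ->/=; rewrite ltW// (lt_trans st).
    by rewrite lebesgue_measure_itv/= lte_fin ltrDl delta0 -EFinD addrAC subrr add0r.
  have all_k k : forall t, 0 < t < T -> t < a + delta ->
      (v t <= (C * 2^-1 ^+ k.+1)%:E)%E.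
    elim: k => [|k IH]; apply: decay.
      apply: ae_sub vB => s vs sT _; rewrite expr0 mulr1.
      by apply: (le_trans (vs sT)); rewrite lee_fin le_max lexx.
    by apply: ae_all => s sT sa; exact: IH.
  move=> t tT ta; apply/eqP; rewrite eq_le v0 andbT.
  have vfin : v t \is a fin_num.
    by rewrite ge0_fin_numE// (le_lt_trans (all_k 0%N t tT ta))// ltry.
  rewrite -(fineK vfin) lee_fin.
  have cv : (C * 2^-1 ^+ k @[k --> \oo] --> C * 0).
    by apply: cvgMr; apply: cvg_expr; rewrite ger0_norm ?invf_lt1// ltr1n.
  rewrite -[leRHS](mulr0 C) -(cvg_lim _ cv)//.
  apply: limr_ge; first by apply/cvg_ex; eexists; exact: cv.
  near=> k; have k0 : (0 < k)%N by near: k; exact: nbhs_infty_gt.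
  rewrite -(prednK k0).
  by rewrite -lee_fin fineK//; exact: all_k.
have all_n n : forall t, 0 < t < T -> t < n%:R * delta -> v t = 0%E.
  elim: n => [|n IH] t; first by rewrite mul0r => /andP[/ltW + _]; rewrite leNgt => /negbTE->.
  rewrite -natr1 mulrDl mul1r; apply: step => //.
  by rewrite mulr_ge0// ltW.
move=> t tT; apply: (all_n (Num.truncn (t / delta)).+1) => //.
by rewrite -ltr_pdivrMr// truncnS_gt.
Unshelve. all: by end_near. Qed.

End Gronwall.

(** * Bounds on the collision kernel *)

Section Kernel.
Context {R : realType}.
Implicit Types x y : R.

Lemma powR_le_add1 x a c : 0 <= x -> 0 <= a <= c -> x `^ a <= 1 + x `^ c.
Proof.
move=> x0 /andP[a0 ac]; have [x1|x1] := leP x 1.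
- apply: (@le_trans _ _ 1); last by rewrite lerDl powR_ge0.
  have [->|xn0] := eqVneq x 0; first by rewrite /powR eqxx; case: (a == 0).
  by rewrite -(powRr0 x) ger_powR// x1 lt_def xn0 x0.
- by apply: (@le_trans _ _ (x `^ c)); [rewrite ler_powR// ltW|rewrite lerDr].
Qed.

Lemma powR_le_1x x a : 0 <= x -> 0 <= a <= 1 -> x `^ a <= 1 + x.
Proof. by move=> x0 a01; rewrite -{2}(powRr1 x0); exact: powR_le_add1. Qed.

Lemma mul_powR x a : 0 < x -> 0 <= a -> x * x `^ a = x `^ (1 + a).
Proof.
by move=> x0 a0; rewrite powRD ?powRr1 ?(ltW x0)// (gt_eqF x0) implybT.
Qed.

Context (alpha beta : R).
Hypotheses (halpha : 0 <= alpha) (hab : alpha <= beta) (hbeta : beta <= 1).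

Lemma sum_kernel_ge0 x y : 0 <= sum_kernel alpha beta x y.
Proof. by rewrite addr_ge0// mulr_ge0// powR_ge0. Qed.

Lemma sum_kernelC x y : sum_kernel alpha beta x y = sum_kernel alpha beta y x.
Proof. by rewrite /sum_kernel addrC mulrC [X in _ + X]mulrC. Qed.

Let exponents a : a = alpha \/ a = beta -> 0 <= a <= 1 /\ 0 <= 1 + a <= 1 + beta.
Proof.
by move: halpha hab hbeta => ? ? ? [->|->]; split; apply/andP; split; lra.
Qed.

Lemma sum_kernel_le x y : 0 < x -> 0 < y ->
  sum_kernel alpha beta x y <= 2 * ((1 + x) * (1 + y)).
Proof.
move=> x0 y0; have [a01 _] := exponents (or_introl erefl).
have [b01 _] := exponents (or_intror erefl).
by rewrite mulr_natl mulr2n; apply: lerD; apply: ler_pM;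
  rewrite ?powR_ge0 ?powR_le_1x ?(ltW x0) ?(ltW y0).
Qed.

Definition high_weight x : R := 1 + x `^ (1 + beta).

Lemma high_weight_ge0 x : 0 <= high_weight x.
Proof. by rewrite addr_ge0 ?powR_ge0. Qed.

Lemma measurable_high_weight : measurable_fun setT high_weight.
Proof. by apply: measurable_funD => //; exact: measurable_powR. Qed.

(** The extra power of x goes into the moment of order 1 + beta and leaves y with
    the weight 1 + y: this is why that moment has to be integrable in time. *)
Lemma sum_kernel_gain x y c : 0 <= c -> 0 < x -> 0 < y ->
  (c + 2 * x) * sum_kernel alpha beta x y <=
  2 * (c + 2) * (high_weight x * (1 + y)).
Proof.
move=> c0 x0 y0.
have gain a : a = alpha \/ a = beta -> (c + 2 * x) * x `^ a <= (c + 2) * high_weight x.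
  move=> /exponents[a01 a1b]; rewrite mulrDl [leRHS]mulrDl -mulrA mul_powR//; last first.
    by case/andP: a01.
  apply: lerD; apply: ler_wpM2l => //; apply: powR_le_add1; rewrite ?(ltW x0)//.
  by case/andP: a01 a1b => -> a1 /andP[_ a1b] /=; lra.
have [a01 _] := exponents (or_introl erefl).
have [b01 _] := exponents (or_intror erefl).
have -> : 2 * (c + 2) * (high_weight x * (1 + y)) =
  (c + 2) * high_weight x * (1 + y) + (c + 2) * high_weight x * (1 + y) by ring.
rewrite mulrDr !mulrA; apply: lerD; apply: ler_pM; rewrite ?powR_ge0 ?powR_le_1x ?(ltW y0)//.
- by rewrite mulr_ge0 ?powR_ge0// addr_ge0// mulr_ge0// ltW.
- by apply: gain; left.
- by rewrite mulr_ge0 ?powR_ge0// addr_ge0// mulr_ge0// ltW.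
- by apply: gain; right.
Qed.

(** For y beyond the cut-off the weight 1 + y has to be paid by the moment of order
    1 + beta in y. *)
Lemma sum_kernel_tail x y : 0 < x -> 0 < y ->
  (1 + y) * sum_kernel alpha beta x y <= 4 * ((1 + x) * high_weight y).
Proof.
move=> x0 y0.
have gain a : a = alpha \/ a = beta -> (1 + y) * y `^ a <= 2 * high_weight y.
  move=> /exponents[a01 a1b]; rewrite mulrDl mul1r mul_powR//; last by case/andP: a01.
  rewrite mulr_natl mulr2n; apply: lerD; apply: powR_le_add1; rewrite ?(ltW y0)//.
  by case/andP: a01 a1b => -> a1 /andP[_ a1b] /=; lra.
have [a01 _] := exponents (or_introl erefl).
have [b01 _] := exponents (or_intror erefl).
have -> : 4 * ((1 + x) * high_weight y) =
  (1 + x) * (2 * high_weight y) + (1 + x) * (2 * high_weight y) by ring.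
rewrite mulrDr mulrCA [X in _ + X <= _]mulrCA; apply: lerD; apply: ler_pM;
  rewrite ?powR_ge0 ?powR_le_1x ?(ltW x0)//.
- by rewrite mulr_ge0 ?powR_ge0// addr_ge0// ltW.
- by apply: gain; right.
- by rewrite mulr_ge0 ?powR_ge0// addr_ge0// ltW.
- by apply: gain; left.
Qed.

End Kernel.

(** * The gain operator *)

(** The integral is the difference of those of the positive and negative parts, also
    when both are infinite. *)
Lemma measurable_partial_integral {d1 d2} {T1 : measurableType d1}
    {T2 : measurableType d2} {R : realType}
    (m2 : {sigma_finite_measure set T2 -> \bar R}) (k : T1 * T2 -> \bar R) :
  measurable_fun setT k -> measurable_fun setT (fun x => \int[m2]_y k (x, y))%E.
Proof.
move=> mk.
have -> : (fun x => \int[m2]_y k (x, y))%E =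
    ((fun x => \int[m2]_y k^\+ (x, y)) \- (fun x => \int[m2]_y k^\- (x, y)))%E.
  apply/funext => x /=; rewrite integralE; congr (_ - _)%E;
    apply: eq_integral => y _; by rewrite ?funeposE ?funenegE.
apply: emeasurable_funB.
- by apply: measurable_fun_fubini_tonelli_F => //; exact: measurable_funepos.
- by apply: measurable_fun_fubini_tonelli_F => //; exact: measurable_funeneg.
Qed.

Section Fragmentation.
Context {R : realType}.
Local Notation mu := (@lebesgue_measure R).
Local Notation Rpos := (halfline R).
Context (b : R -> R -> R -> R) (beta0 : R).
Hypothesis hb : daughter_distribution b.
Hypothesis hmass : forall x y : R, 0 < x -> 0 < y ->
  (\int[mu]_(z in `]0%R, (x + y)%R[) (z * b z x y)%:E = (x + y)%:E)%E.
Hypothesis hnumber : forall x y : R, 0 < x -> 0 < y ->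
  (\int[mu]_(z in `]0%R, (x + y)%R[) (b z x y)%:E <= beta0%:E)%E.

Definition fragments (phi : R -> R) (x y : R) : R :=
  \int[mu]_(z in `]0, (x + y)[) (phi z * b z x y).

Lemma measurable_halfline : measurable Rpos.
Proof. exact: measurable_itv. Qed.

Let bpos : R * (R * R) -> R :=
  (fun p : R * (R * R) => b p.1 p.2.1 p.2.2) \_ (Rpos `*` (Rpos `*` Rpos)).

Let measurable_bpos : measurable_fun setT bpos.
Proof.
apply/(measurable_restrictT _ _).1; last exact: hb.1.
apply: measurableX; [|apply: measurableX]; exact: measurable_halfline.
Qed.

Let bposE (z x y : R) : 0 < x -> 0 < y -> 0 < z -> bpos (z, (x, y)) = b z x y.
Proof.
move=> x0 y0 z0; rewrite /bpos /patch ifT// inE.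
by split; [|split]; rewrite /= /halfline /= in_itv/= andbT.
Qed.

Let measurable_b (x y : R) : 0 < x -> 0 < y ->
  measurable_fun `]0, (x + y)[%classic (fun z : R => b z x y).
Proof.
move=> x0 y0; apply: (eq_measurable_fun (fun z => bpos (z, (x, y)))).
  by move=> z; rewrite inE /= in_itv/= => /andP[z0 _]; rewrite bposE.
by apply: measurable_funTS; apply: measurableT_comp => //; exact: measurable_pair2.
Qed.

(** The constant part of the bound on phi is paid by the number of fragments, the
    linear part by mass conservation. *)
Lemma fragments_le (phi : R -> R) (c d x y : R) : measurable_fun setT phi ->
  0 <= c -> 0 <= d -> (forall z, 0 < z -> `|phi z| <= c + d * z) ->
  0 < x -> 0 < y -> `|fragments phi x y| <= c * beta0 + d * (x + y).
Proof.
move=> mphi c0 d0 phile x0 y0.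
have mb := measurable_b x0 y0.
have mI : measurable `]0, (x + y)[%classic by exact: measurable_itv.
have b0 z : `]0, (x + y)[%classic z -> 0 <= b z x y.
  by rewrite /= in_itv/= => /andP[z0 _]; exact: hb.2.
have z0 z : `]0, (x + y)[%classic z -> 0 <= z.
  by rewrite /= in_itv/= => /andP[/ltW].
have mphib : measurable_fun `]0, (x + y)[ (EFin \o (fun z => phi z * b z x y)).
  by apply/measurable_EFinP; apply: measurable_funM => //; exact: measurable_funTS.
have mzb : measurable_fun `]0, (x + y)[ (fun z => z * b z x y).
  by apply: measurable_funM => //; exact: measurable_funTS.
have : (`|\int[mu]_(z in `]0%R, (x + y)%R[) (phi z * b z x y)%:E| <=
   (c * beta0 + d * (x + y))%:E)%E.
  apply: (le_trans (le_abse_integral mu mI mphib)).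
  apply: (@le_trans _ _ (\int[mu]_(z in `]0%R, (x + y)%R[)
      (c%:E * (b z x y)%:E + d%:E * (z * b z x y)%:E))%E).
    apply: ge0_le_integral => //.
    - exact: measurableT_comp.
    - by apply: emeasurable_funD; apply: emeasurable_funM => //; apply/measurable_EFinP.
    - move=> z zI /=; rewrite -!EFinM -EFinD lee_fin normrM (ger0_norm (b0 _ zI)).
      rewrite mulrA -mulrDl ler_wpM2r// ?b0// phile//.
      by move: zI; rewrite /= in_itv/= => /andP[].
  rewrite ge0_integralD//; first last.
  - by apply: emeasurable_funM => //; apply/measurable_EFinP.
  - by move=> z zI; rewrite -EFinM lee_fin mulr_ge0// mulr_ge0 ?(b0 _ zI) ?(z0 _ zI).
  - by apply: emeasurable_funM => //; apply/measurable_EFinP.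
  - by move=> z zI; rewrite -EFinM lee_fin mulr_ge0 ?(b0 _ zI).
  rewrite !ge0_integralZl//; try (by apply/measurable_EFinP);
    try (by rewrite lee_fin);
    try (by move=> z zI; rewrite lee_fin ?mulr_ge0 ?(b0 _ zI) ?(z0 _ zI)).
  by rewrite hmass// [leRHS]EFinD (EFinM c) (EFinM d) leeD// lee_wpmul2l// hnumber.
rewrite /fragments /Rintegral; case: (integral _ _ _) => //= r.
Qed.

Lemma zeta_le_bounded (phi : R -> R) (c x y : R) : measurable_fun setT phi ->
  0 <= c -> (forall z, `|phi z| <= c) -> 0 < x -> 0 < y ->
  `|zeta b phi x y| <= c * (beta0 + 2).
Proof.
move=> mphi c0 phile x0 y0.
have h : `|fragments phi x y| <= c * beta0.
  rewrite -[leRHS]addr0 -[X in _ + X](mul0r (x + y)).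
  by apply: fragments_le => // z _; rewrite mul0r addr0.
rewrite /zeta -/(fragments phi x y).
have -> : c * (beta0 + 2) = c * beta0 + c + c by ring.
by apply: (le_trans (ler_normB _ _)); rewrite lerD// (le_trans (ler_normB _ _))// lerD.
Qed.

Lemma measurable_zeta (phi : R -> R) : measurable_fun setT phi ->
  measurable_fun setT
    (fun p : R * R => if (0 < p.1) && (0 < p.2) then zeta b phi p.1 p.2 else 0).
Proof.
move=> mphi.
pose k (q : (R * R) * R) :=
  (if q.2 < q.1.1 + q.1.2 then phi q.2 * bpos (q.2, q.1) else 0)%:E.
have mk : measurable_fun setT k.
  apply/measurable_EFinP; apply: measurable_fun_ifT => //.
  - apply: measurable_fun_ltr => //.
    by apply: measurable_funD; apply: measurableT_comp => //; exact: measurableT_comp.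
  - apply: measurable_funM; apply: measurableT_comp => //.
    by apply: measurable_fun_pair.
apply: (eq_measurable_fun (fun p : R * R => if (0 < p.1) && (0 < p.2) then
    fine (\int[mu]_z k (p, z))%E - phi p.1 - phi p.2 else 0)).
  move=> [x y] _ /=; case: ifPn => // /andP[x0 y0].
  rewrite /zeta /Rintegral; congr (fine _ - _ - _).
  rewrite [RHS]integral_mkcond; apply: eq_integral => z _.
  rewrite /k /patch /= mem_setE in_itv/=.
  have [z0|z0] := ltP 0 z; rewrite /=; first by case: ifP => // _; rewrite bposE.
  case: ifP => // _; rewrite /bpos /patch ifF ?mulr0//.
  apply/negbTE; rewrite notin_setE => -[/=].
  by rewrite /halfline /= in_itv/= andbT ltNge z0.
apply: measurable_fun_ifT => //.
- by apply: measurable_and; apply: measurable_fun_ltr.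
- apply: measurable_funB; last exact: measurableT_comp.
  apply: measurable_funB; last exact: measurableT_comp.
  apply: measurableT_comp; first exact: fine_measurable.
  exact: measurable_partial_integral.
Qed.

End Fragmentation.

(** * The difference of two solutions *)

Section Difference.
Context {R : realType}.
Local Notation mu := (@lebesgue_measure R).
Context (alpha beta : R).
Hypotheses (halpha : 0 <= alpha) (hab : alpha <= beta) (hbeta : beta <= 1).
Context (b : R -> R -> R -> R) (beta0 : R).
Hypothesis hb : daughter_distribution b.
Hypothesis hmass : forall x y : R, 0 < x -> 0 < y ->
  (\int[mu]_(z in `]0%R, (x + y)%R[) (z * b z x y)%:E = (x + y)%:E)%E.
Hypothesis hbeta0 : 0 <= beta0.
Hypothesis hnumber : forall x y : R, 0 < x -> 0 < y ->
  (\int[mu]_(z in `]0%R, (x + y)%R[) (b z x y)%:E <= beta0%:E)%E.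

(** Cutting zeta off to positive sizes makes it measurable on the whole plane. *)
Definition rate (phi : R -> R) (p : R * R) : R :=
  (if (0 < p.1) && (0 < p.2) then zeta b phi p.1 p.2 else 0) *
  sum_kernel alpha beta p.1 p.2.

(** S and E stand for the sum and the difference of two solutions, extended by 0
    outside of ]0, T[ and of the positive sizes. *)
Context (T C : R) (S E : R -> R -> R).
Hypothesis C0 : 0 <= C.
Hypothesis mS : measurable_fun setT (fun p : R * R => S p.1 p.2).
Hypothesis mE : measurable_fun setT (fun p : R * R => E p.1 p.2).
Hypothesis ES : forall s x : R, `|E s x| <= S s x.
Hypothesis S_size : forall s x : R, x <= 0 -> S s x = 0.
Hypothesis S_time : forall s x : R, ~~ (0 < s < T) -> S s x = 0.
Hypothesis S_first : {ae mu, forall s : R,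
  (\int[mu]_x ((1 + x) * S s x)%:E <= C%:E)%E}.
Hypothesis S_fin : forall s : R, (\int[mu]_x (S s x)%:E < +oo)%E.
Hypothesis S_high :
  (\int[mu]_s \int[mu]_x (high_weight beta x * S s x)%:E < +oo)%E.

(** As f(x) f(y) - g(x) g(y) = (S(x) E(y) + E(x) S(y)) / 2, the flux is twice the
    difference of the two collision integrands, and the factor 1/2 of the equation
    becomes 1/4. *)
Definition flux (phi : R -> R) (q : R * (R * R)) : R :=
  rate phi q.2 * (S q.1 q.2.1 * E q.1 q.2.2 + E q.1 q.2.1 * S q.1 q.2.2).

Hypothesis balance : forall (t c : R) (phi : R -> R), 0 <= t < T ->
  measurable_fun setT phi -> (forall x, `|phi x| <= c) ->
  (\int[mu]_x (phi x * E t x)%:E =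
   4^-1%:E * \int[mu \x leb2]_(q in `]0%R, t[%classic `*` setT) (flux phi q)%:E)%E.

Let S0 (s x : R) : 0 <= S s x.
Proof. exact: le_trans (ES s x). Qed.

Let E_size (s x : R) : x <= 0 -> E s x = 0.
Proof. by move=> x0; apply/eqP; rewrite -normr_le0 -(S_size s x0). Qed.

Let mSt (s : R) : measurable_fun setT (S s).
Proof. exact: (measurable_section s mS). Qed.

Let mEt (s : R) : measurable_fun setT (E s).
Proof. exact: (measurable_section s mE). Qed.

Let integrable_S (s : R) : mu.-integrable setT (fun x => (S s x)%:E).
Proof.
apply/integrableP; split; first by apply/measurable_EFinP; exact: mSt.
by under eq_integral do rewrite gee0_abs ?lee_fin//.
Qed.

Lemma integrable_pairing (s c : R) (phi : R -> R) : measurable_fun setT phi ->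
  (forall x, `|phi x| <= c) -> mu.-integrable setT (fun x => (phi x * E s x)%:E).
Proof.
move=> mphi phic.
apply: (le_integrable measurableT _ _ (integrableZl measurableT c (integrable_S s))).
  by apply/measurable_EFinP; apply: measurable_funM => //; exact: mEt.
move=> x _ /=; rewrite lee_fin !normrM (ger0_norm (S0 _ _)).
by rewrite ler_pM// (le_trans (phic x))// ler_norm.
Qed.

Lemma measurable_rate (phi : R -> R) : measurable_fun setT phi ->
  measurable_fun setT (rate phi).
Proof.
move=> mphi; apply: measurable_funM; first exact: measurable_zeta.
apply: measurable_funD; apply: measurable_funM;
  by apply: (measurableT_comp (measurable_powR _)).
Qed.

Lemma measurable_flux (phi : R -> R) : measurable_fun setT phi ->
  measurable_fun setT (flux phi).
Proof.
move=> mphi; apply: measurable_funM.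
  by apply: measurableT_comp; [exact: measurable_rate|exact: measurable_snd].
apply: measurable_funD; apply: measurable_funM;
  by [exact: (measurable_fun_comp2 mS measurable_time measurable_size1)
     |exact: (measurable_fun_comp2 mS measurable_time measurable_size2)
     |exact: (measurable_fun_comp2 mE measurable_time measurable_size1)
     |exact: (measurable_fun_comp2 mE measurable_time measurable_size2)].
Qed.

Let m_weight (w : R -> R) (f : R -> R -> R) : measurable_fun setT w ->
  measurable_fun setT (fun p : R * R => f p.1 p.2) ->
  measurable_fun setT (fun p : R * R => w p.2 * f p.1 p.2).
Proof. by move=> mw mf; apply: measurable_funM => //; exact: measurableT_comp. Qed.

Let m_1x : measurable_fun setT (fun x : R => 1 + x).
Proof. exact: measurable_funD. Qed.

Let wS_ge0 (w : R -> R) (s x : R) : (forall x, 0 < x -> 0 <= w x) -> 0 <= w x * S s x.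
Proof.
move=> w0; have [x0|x0] := ltP 0 x; first by rewrite mulr_ge0// w0.
by rewrite S_size// mulr0.
Qed.

Let x1_ge0 (x : R) : 0 < x -> 0 <= 1 + x.
Proof. by move=> x0; rewrite addr_ge0// ltW. Qed.

Lemma flux_bounded (c : R) (phi : R -> R) (q : R * (R * R)) :
  measurable_fun setT phi -> (forall x, `|phi x| <= c) ->
  `|flux phi q| <= 4 * (c * (beta0 + 2)) *
    (((1 + q.2.1) * S q.1 q.2.1) * ((1 + q.2.2) * S q.1 q.2.2)).
Proof.
case: q => s [x y] mphi phic; rewrite /flux /rate /=.
have c0 : 0 <= c := le_trans (normr_ge0 _) (phic 0).
have [x0|x0] := ltP 0 x; last first.
  by rewrite (S_size _ x0) (E_size _ x0) !(mul0r, mulr0, addr0) normr0.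
have [y0|y0] := ltP 0 y; last first.
  by rewrite (S_size _ y0) (E_size _ y0) !(mul0r, mulr0, addr0) normr0.
rewrite /= !normrM (ger0_norm (sum_kernel_ge0 _ _ _ _)).
have -> : 4 * (c * (beta0 + 2)) * ((1 + x) * S s x * ((1 + y) * S s y)) =
  c * (beta0 + 2) * (2 * ((1 + x) * (1 + y))) * (S s x * S s y + S s x * S s y) by ring.
apply: ler_pM => //.
- by rewrite mulr_ge0// sum_kernel_ge0.
- apply: ler_pM => //; first exact: sum_kernel_ge0.
  + exact: zeta_le_bounded.
  + exact: sum_kernel_le.
- apply: le_trans (ler_normD _ _) _; rewrite !normrM !(ger0_norm (S0 _ _)).
  by rewrite lerD// ?ler_wpM2l ?ler_wpM2r.
Qed.

Definition moment (w : R -> R) (f : R -> R -> R) (s : R) : \bar R :=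
  (\int[mu]_x (w x * f s x)%:E)%E.

Let measurable_moment (w : R -> R) (f : R -> R -> R) : measurable_fun setT w ->
  measurable_fun setT (fun p : R * R => f p.1 p.2) ->
  measurable_fun setT (moment w f).
Proof.
move=> mw mf.
apply: (@measurable_partial_integral _ _ _ _ _ mu (fun p => (w p.2 * f p.1 p.2)%:E)).
by apply/measurable_EFinP; exact: m_weight.
Qed.

Let first_slab (D : set R) (f : R -> \bar R) : measurable D ->
  measurable_fun setT f -> (forall s, 0 <= f s)%E ->
  (\int[mu]_(s in D) (moment (fun x => (1 + x)%R) S s * f s) <=
   C%:E * \int[mu]_(s in D) f s)%E.
Proof.
move=> mD mf f0.
have mfirst := measurable_moment m_1x mS.
have first0 s : (0 <= moment (fun x => (1 + x)%R) S s)%E.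
  by apply: integral_ge0 => x _; rewrite lee_fin; apply: wS_ge0; exact: x1_ge0.
rewrite -ge0_integralZl//; last exact: measurable_funTS.
apply: ae_ge0_le_integral => //.
- by move=> s _; exact: mule_ge0.
- by apply: measurable_funTS; exact: emeasurable_funM.
- by move=> s _; apply: mule_ge0 => //; rewrite lee_fin.
- by apply: measurable_funTS; exact: emeasurable_funM.
- by apply: ae_sub S_first => s Ss _; exact: lee_wpmul2r.
Qed.

Let first_slab2 (D : set R) : measurable D ->
  (\int[mu \x leb2]_(q in D `*` setT)
     (((1 + q.2.1) * S q.1 q.2.1) * ((1 + q.2.2) * S q.1 q.2.2))%:E
   <= (C ^+ 2)%:E * mu D)%E.
Proof.
move=> mD.
have mw := m_weight m_1x mS.
have w0 (p : R * R) : 0 <= (1 + p.2) * S p.1 p.2 by apply: wS_ge0; exact: x1_ge0.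
rewrite (integral_slab_prodM mD mw mw w0 w0) /=.
have mfirst := measurable_moment m_1x mS.
have first0 s : (0 <= moment (fun x => (1 + x)%R) S s)%E.
  by apply: integral_ge0 => x _; rewrite lee_fin; exact: (w0 (s, x)).
apply: le_trans (first_slab mD mfirst first0) _.
rewrite expr2 EFinM -muleA lee_wpmul2l//.
have := first_slab mD (measurable_cst 1%E) (fun=> lee01).
under eq_integral do rewrite mule1.
by rewrite integral_cst// mul1e.
Qed.

Definition slice (r t : R) : set R := `]0, t[%classic `\` `]0, r[%classic.

Let measurable_slice (r t : R) : measurable (slice r t).
Proof. exact: measurableD. Qed.

Let mu_slice (r t : R) : 0 <= r -> r <= t -> (mu (slice r t) <= (t - r)%:E)%E.
Proof.
move=> r0 rt; apply: (@le_trans _ _ (mu `[r, t]%classic)).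
  apply: le_measure; rewrite ?inE//; first exact: measurable_slice.
  move=> s [] /=; rewrite !in_itv/= => /andP[s0 st] /negP.
  by rewrite s0/= -leNgt => -> /=; exact: ltW.
rewrite lebesgue_measure_itv/= lte_fin; case: ifPn => //.
by move=> _; rewrite lee_fin subr_ge0.
Qed.

Let measurable_first_prod : measurable_fun setT (fun q : R * (R * R) =>
   ((1 + q.2.1) * S q.1 q.2.1) * ((1 + q.2.2) * S q.1 q.2.2)).
Proof.
have mw := m_weight m_1x mS.
apply: measurable_funM;
  by [exact: (measurable_fun_comp2 mw measurable_time measurable_size1)
     |exact: (measurable_fun_comp2 mw measurable_time measurable_size2)].
Qed.

Let first_prod_ge0 (q : R * (R * R)) :
  0 <= ((1 + q.2.1) * S q.1 q.2.1) * ((1 + q.2.2) * S q.1 q.2.2).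
Proof. by apply: mulr_ge0; apply: wS_ge0; exact: x1_ge0. Qed.

Let slab_flux_le (D : set R) (c : R) (phi : R -> R) : measurable D ->
  measurable_fun setT phi -> (forall x, `|phi x| <= c) ->
  (\int[mu \x leb2]_(q in D `*` setT) `|(flux phi q)%:E| <=
   (4 * (c * (beta0 + 2)) * C ^+ 2)%:E * mu D)%E.
Proof.
move=> mD mphi phic.
have mDT : measurable (D `*` [set: R * R]) by exact: measurableX.
pose k := 4 * (c * (beta0 + 2)).
have c0 : 0 <= c := le_trans (normr_ge0 _) (phic 0).
have k0 : 0 <= k by rewrite !mulr_ge0// addr_ge0.
apply: (@le_trans _ _ (\int[mu \x leb2]_(q in D `*` setT)
   (k%:E * (((1 + q.2.1) * S q.1 q.2.1) * ((1 + q.2.2) * S q.1 q.2.2))%:E))%E).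
  apply: ge0_le_integral => //.
  - apply: measurable_funTS; apply: measurableT_comp => //.
    by apply/measurable_EFinP; exact: measurable_flux.
  - apply: measurable_funTS; apply: emeasurable_funM => //.
    exact/measurable_EFinP.
  - by move=> q _; rewrite abse_EFin -EFinM lee_fin; exact: flux_bounded.
rewrite ge0_integralZl//.
- rewrite [leRHS](_ : _ = k%:E * ((C ^+ 2)%:E * mu D))%E; last by rewrite muleA -EFinM.
  by rewrite lee_wpmul2l//; exact: first_slab2.
- by apply: measurable_funTS; apply/measurable_EFinP.
- by move=> q _; rewrite lee_fin.
Qed.

Let integrable_flux (D : set R) (c : R) (phi : R -> R) : measurable D ->
  (mu D < +oo)%E -> measurable_fun setT phi -> (forall x, `|phi x| <= c) ->
  (mu \x leb2)%E.-integrable (D `*` setT) (fun q => (flux phi q)%:E).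
Proof.
move=> mD Dfin mphi phic; apply/integrableP; split.
  by apply: measurable_funTS; apply/measurable_EFinP; exact: measurable_flux.
apply: (le_lt_trans (slab_flux_le mD mphi phic)).
have c0 : 0 <= c := le_trans (normr_ge0 _) (phic 0).
by apply: lte_mul_pinfty => //; rewrite lee_fin !mulr_ge0 ?sqr_ge0// addr_ge0.
Qed.

Lemma balance_slice (r t c : R) (phi : R -> R) : 0 <= r -> r <= t -> t < T ->
  measurable_fun setT phi -> (forall x, `|phi x| <= c) ->
  (\int[mu]_x (phi x * E t x)%:E = \int[mu]_x (phi x * E r x)%:E +
   4^-1%:E * \int[mu \x leb2]_(q in slice r t `*` setT) (flux phi q)%:E)%E.
Proof.
move=> r0 rt tT mphi phic; have t0 := le_trans r0 rt.
rewrite !(balance (c := c))// ?t0 ?r0 ?(le_lt_trans rt)//.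
have sub : `]0, r[%classic `<=` `]0, t[%classic.
  by apply: subset_itvl; rewrite bnd_simp.
have -> : `]0, t[%classic `*` [set: R * R] =
    (`]0, r[%classic `*` setT) `|` (slice r t `*` setT).
  apply/seteqP; split => -[s p].
    by rewrite -{1}(setDUK sub) => -[[s1|s1] _]; [left|right].
  by case=> -[s1 _]; split => //; [exact: sub|case: s1].
rewrite integral_setU.
- rewrite muleDr//; apply: fin_num_adde_defl.
  apply: integrable_fin_num; first by apply: measurableX => //; exact: measurable_slice.
  apply: (integrable_flux (measurable_slice r t) _ mphi phic).
  by rewrite (le_lt_trans (mu_slice r0 rt))// ltry.
- by apply: measurableX.
- by apply: measurableX => //; exact: measurable_slice.
- by apply: measurable_funTS; apply/measurable_EFinP; exact: measurable_flux.
- rewrite disj_set2E; apply/eqP; rewrite -subset0 => -[s p] [/= [s1 _] [[_ s2] _]].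
  exact: s2.
Qed.

Lemma le_pairing (r t c : R) (phi : R -> R) (B : \bar R) :
  0 <= r -> r <= t -> t < T ->
  measurable_fun setT phi -> (forall x, `|phi x| <= c) ->
  (4^-1%:E * \int[mu \x leb2]_(q in slice r t `*` setT) (flux phi q)%:E <= B)%E ->
  (\int[mu]_x (phi x * E t x)%:E <= \int[mu]_x (phi x * E r x)%:E + B)%E.
Proof. by move=> r0 rt tT mphi phic HB; rewrite (balance_slice r0 rt tT mphi phic) leeD2l. Qed.

(** One quarter of the bound 4 (beta0 + 2) C^2, per unit of time, on the flux of a
    test function with values in [-1, 1]. *)
Definition lip : R := (beta0 + 2) * C ^+ 2.

Let lip0 : 0 <= lip. Proof. by rewrite mulr_ge0 ?sqr_ge0// addr_ge0. Qed.

(** The test function is the sign of the increment itself. *)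
Lemma lipschitz_L1 (r t : R) : 0 <= r -> r <= t -> t < T ->
  (\int[mu]_x `|E t x - E r x|%:E <= (lip * (t - r))%:E)%E.
Proof.
move=> r0 rt tT.
pose phi x := Num.sg (E t x - E r x).
have mphi : measurable_fun setT phi.
  by apply: measurableT_comp; [exact: measurable_sgr|apply: measurable_funB; exact: mEt].
have phi1 x : `|phi x| <= 1.
  by rewrite /phi normr_sg; case: (_ != 0).
have -> : (\int[mu]_x `|E t x - E r x|%:E =
    \int[mu]_x (phi x * E t x)%:E - \int[mu]_x (phi x * E r x)%:E)%E.
  rewrite -integralB_EFin//.
  - by apply: eq_integral => x _; rewrite -EFinB -mulrBr /phi -normrEsg.
  - exact: integrable_pairing phi1.
  - exact: integrable_pairing phi1.
rewrite (balance_slice r0 rt tT mphi phi1) addeAC subee ?add0e; last first.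
  by apply: integrable_fin_num => //; exact: integrable_pairing phi1.
have mD := measurable_slice r t.
apply: (@le_trans _ _ (4^-1%:E * ((4 * (1 * (beta0 + 2)) * C ^+ 2)%:E * mu (slice r t)))%E).
  apply: lee_wpmul2l; first by rewrite lee_fin.
  apply: le_trans (slab_flux_le mD mphi phi1).
  apply: le_integral_ge0 => //; first exact: measurableX.
  - by apply: measurable_funTS; apply/measurable_EFinP; exact: measurable_flux.
  - apply: measurable_funTS; apply: measurableT_comp => //.
    by apply/measurable_EFinP; exact: measurable_flux.
  - by move=> q _; rewrite lee_abs.
rewrite muleA -EFinM.
have -> : 4^-1 * (4 * (1 * (beta0 + 2)) * C ^+ 2) = lip by rewrite /lip; field.
by rewrite [leRHS]EFinM lee_wpmul2l ?lee_fin// mu_slice.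
Qed.

Definition cut (n : nat) (x : R) : R :=
  if (0 < x) && (x <= n%:R) then 1 + x else 0.

Definition tail_weight (n : nat) (x : R) : R :=
  if n%:R < x then high_weight beta x else 0.

Let cut_ge0 n x : 0 <= cut n x.
Proof. by rewrite /cut; case: ifPn => // /andP[/x1_ge0]. Qed.

Let cut_le n x : cut n x <= 1 + n%:R.
Proof. by rewrite /cut; case: ifPn => [/andP[_]|_]; [rewrite lerD2l|rewrite addr_ge0]. Qed.

Let cut_le1x n x : 0 < x -> cut n x <= 1 + x.
Proof. by rewrite /cut => x0; case: ifPn => // _; exact: x1_ge0. Qed.

Let tail_weight_ge0 n x : 0 <= tail_weight n x.
Proof. by rewrite /tail_weight; case: ifPn => // _; exact: high_weight_ge0. Qed.

Let measurable_cut n : measurable_fun setT (cut n).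
Proof.
apply: measurable_fun_ifT => //.
by apply: measurable_and; [exact: measurable_fun_ltr|exact: measurable_fun_ler].
Qed.

Let measurable_tail_weight n : measurable_fun setT (tail_weight n).
Proof.
apply: measurable_fun_ifT => //; first exact: measurable_fun_ltr.
exact: measurable_high_weight.
Qed.

(** If the signs of a and e differ, then |e| is at most |a - e|. *)
Let sg_defect (a e : R) : - (Num.sg a * e) <= 2 * `|a - e| - `|e|.
Proof.
have [a0|a0|->] := ltgtP a 0.
- rewrite ltr0_sg// mulN1r opprK.
  by case: (ger0P e) => ?; case: (ger0P (a - e)) => ?; lra.
- rewrite gtr0_sg// mul1r.
  by case: (ger0P e) => ?; case: (ger0P (a - e)) => ?; lra.
- by rewrite sgr0 mul0r oppr0 sub0r normrN mulr_natl mulr2n addrK.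
Qed.

Definition cut_sign (n : nat) (t x : R) : R := cut n x * Num.sg (E t x).

(** J is the gain at the pair (x, y).  Write e = E s y and
    d = |E t y - E s y|.  By sg_defect the loss at y is at most
    cut n y (2 d - |e|).  For y <= n the weight cut n y is 1 + y, which cancels
    the part 1 + y of the bound beta0 + x + y + 1 + x on the other terms, and
    beta0 + 2 x is left.  For y > n there is no loss, and 1 + y remains. *)
Lemma half_flux (n : nat) (t s x y J : R) : 0 < x -> 0 < y ->
  `|J| <= beta0 + (x + y) ->
  (J - cut_sign n t x - cut_sign n t y) * sum_kernel alpha beta x y * (S s x * E s y) <=
  2 * (beta0 + 2) * (high_weight beta x * S s x * ((1 + y) * `|E s y|))
  + 4 * ((1 + x) * S s x * (tail_weight n y * S s y))
  + 4 * (1 + n%:R) ^+ 2 * ((1 + x) * S s x * `|E t y - E s y|).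
Proof.
move=> x0 y0 Jle; set phi := cut_sign n t.
set K := sum_kernel _ _ _ _; set e := E s y; set d := `|E t y - e|.
have K0 : 0 <= K by exact: sum_kernel_ge0.
have Sx0 : 0 <= S s x by exact: S0.
have e0 : 0 <= `|e| by [].
have d0 : 0 <= d by exact: normr_ge0.
have x1 : 0 <= 1 + x := x1_ge0 x0.
have y1 : 0 <= 1 + y := x1_ge0 y0.
have eS : `|e| <= S s y by exact: ES.
have gain : (beta0 + 2 * x) * K <= 2 * (beta0 + 2) * (high_weight beta x * (1 + y)).
  exact: sum_kernel_gain.
have tail : (1 + y) * K <= 4 * ((1 + x) * high_weight beta y).
  exact: sum_kernel_tail.
have Kle : K <= 2 * ((1 + x) * (1 + y)) by exact: sum_kernel_le.
have phix : `|phi x| <= 1 + x.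
  rewrite /phi /cut_sign normrM (ger0_norm (cut_ge0 _ _)) normr_sg.
  by apply: (le_trans _ (cut_le1x n x0)); rewrite ler_piMr//; case: (_ != 0).
have phiy : - (phi y * e) <= cut n y * (2 * d - `|e|).
  by rewrite /phi /cut_sign -mulrA -mulrN ler_wpM2l// sg_defect.
have Jx : (J - phi x) * e <= (beta0 + x + y + 1 + x) * `|e|.
  apply: (le_trans (ler_norm _)); rewrite normrM ler_wpM2r//.
  by apply: (le_trans (ler_normB _ _)); lra.
have SK0 : 0 <= S s x * K by exact: mulr_ge0.
have T1 : S s x * K * ((beta0 + 2 * x) * `|e|) <=
    2 * (beta0 + 2) * (high_weight beta x * S s x * ((1 + y) * `|e|)).
  have -> : S s x * K * ((beta0 + 2 * x) * `|e|) =
    (beta0 + 2 * x) * K * (S s x * `|e|) by ring.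
  have -> : 2 * (beta0 + 2) * (high_weight beta x * S s x * ((1 + y) * `|e|)) =
    2 * (beta0 + 2) * (high_weight beta x * (1 + y)) * (S s x * `|e|) by ring.
  by rewrite ler_wpM2r// mulr_ge0.
have T2 : 0 <= 4 * ((1 + x) * S s x * (tail_weight n y * S s y)).
  by rewrite !mulr_ge0.
have T3 : 0 <= 4 * (1 + n%:R) ^+ 2 * ((1 + x) * S s x * d).
  by rewrite mulr_ge0 ?mulr_ge0 ?sqr_ge0.
have -> : (J - phi x - phi y) * K * (S s x * e) =
    S s x * K * ((J - phi x) * e + - (phi y * e)) by ring.
have [yn|ny] := leP y n%:R.
- have cy : cut n y = 1 + y by rewrite /cut y0 yn.
  have step : (J - phi x) * e + - (phi y * e) <=
      (beta0 + 2 * x) * `|e| + 2 * (1 + n%:R) * d.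
    have : (1 + y) * d <= (1 + n%:R) * d by rewrite ler_wpM2r// lerD2l.
    rewrite cy in phiy; move: Jx phiy; lra.
  apply: (le_trans (ler_wpM2l SK0 step)); rewrite mulrDr.
  have T3' : S s x * K * (2 * (1 + n%:R) * d) <=
      4 * (1 + n%:R) ^+ 2 * ((1 + x) * S s x * d).
    have -> : S s x * K * (2 * (1 + n%:R) * d) =
      K * (2 * (1 + n%:R) * (S s x * d)) by ring.
    have -> : 4 * (1 + n%:R) ^+ 2 * ((1 + x) * S s x * d) =
      2 * ((1 + x) * (1 + n%:R)) * (2 * (1 + n%:R) * (S s x * d)) by ring.
    apply: ler_wpM2r; first by rewrite !mulr_ge0// addr_ge0.
    apply: (le_trans Kle); rewrite ler_wpM2l// ler_wpM2l ?x1_ge0//.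
    by rewrite lerD2l.
  move: T1 T2 T3'; lra.
- have cy : cut n y = 0 by rewrite /cut y0/= leNgt ny.
  have step : (J - phi x) * e + - (phi y * e) <=
      (beta0 + 2 * x) * `|e| + (1 + y) * S s y.
    have : (1 + y) * `|e| <= (1 + y) * S s y by rewrite ler_wpM2l// x1_ge0.
    rewrite cy mul0r in phiy; move: Jx phiy; lra.
  apply: (le_trans (ler_wpM2l SK0 step)); rewrite mulrDr.
  have T2' : S s x * K * ((1 + y) * S s y) <=
      4 * ((1 + x) * S s x * (tail_weight n y * S s y)).
    rewrite /tail_weight ny.
    have -> : S s x * K * ((1 + y) * S s y) = (1 + y) * K * (S s x * S s y) by ring.
    have -> : 4 * ((1 + x) * S s x * (high_weight beta y * S s y)) =
      4 * ((1 + x) * high_weight beta y) * (S s x * S s y) by ring.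
    by rewrite ler_wpM2r// mulr_ge0.
  move: T1 T2' T3; lra.
Qed.

Let highS (p : R * R) : R := high_weight beta p.2 * S p.1 p.2.
Let firstS (p : R * R) : R := (1 + p.2) * S p.1 p.2.
Let firstE (p : R * R) : R := (1 + p.2) * `|E p.1 p.2|.
Let tailS (n : nat) (p : R * R) : R := tail_weight n p.2 * S p.1 p.2.
Let drift (t : R) (p : R * R) : R := `|E t p.2 - E p.1 p.2|.

Let mabsE : measurable_fun setT (fun p : R * R => `|E p.1 p.2|).
Proof. exact: measurableT_comp. Qed.

Let mabsEt (t : R) : measurable_fun setT (fun x => `|E t x|).
Proof. exact: (measurable_section t mabsE). Qed.

Let measurable_highS : measurable_fun setT highS.
Proof. by apply: m_weight => //; exact: measurable_high_weight. Qed.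
Let measurable_firstS : measurable_fun setT firstS.
Proof. exact: m_weight. Qed.
Let measurable_firstE : measurable_fun setT firstE.
Proof. exact: (m_weight (f := fun s x => `|E s x|)). Qed.
Let measurable_tailS n : measurable_fun setT (tailS n).
Proof. exact: m_weight. Qed.
Let measurable_drift t : measurable_fun setT (drift t).
Proof.
apply: measurableT_comp => //; apply: measurable_funB => //.
by apply: measurableT_comp; [exact: mEt|exact: measurable_snd].
Qed.

Let highS_ge0 p : 0 <= highS p.
Proof. by rewrite mulr_ge0// high_weight_ge0. Qed.
Let firstS_ge0 p : 0 <= firstS p.
Proof. by apply: wS_ge0; exact: x1_ge0. Qed.
Let firstE_le p : firstE p <= firstS p.
Proof.
rewrite /firstE /firstS; have [x0|x0] := ltP 0 p.2.
  by rewrite ler_wpM2l// x1_ge0.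
by rewrite E_size// S_size// normr0.
Qed.
Let firstE_ge0 p : 0 <= firstE p.
Proof.
rewrite /firstE; have [x0|x0] := ltP 0 p.2; first by rewrite mulr_ge0// x1_ge0.
by rewrite E_size// normr0 mulr0.
Qed.
Let tailS_ge0 n p : 0 <= tailS n p.
Proof. by rewrite mulr_ge0. Qed.
Let drift_ge0 t p : 0 <= drift t p.
Proof. exact: normr_ge0. Qed.

Let sym (a c : R * R -> R) (q : R * (R * R)) : R :=
  a (q.1, q.2.1) * c (q.1, q.2.2) + c (q.1, q.2.1) * a (q.1, q.2.2).

Let measurable_sym (a c : R * R -> R) (k : R) : measurable_fun setT a ->
  measurable_fun setT c -> measurable_fun setT (fun q => (k * sym a c q)%:E).
Proof.
move=> ma mc; apply/measurable_EFinP; apply: measurable_funM => //.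
apply: measurable_funD; apply: measurable_funM.
- exact: measurable_fun_comp2 ma measurable_time measurable_size1.
- exact: measurable_fun_comp2 mc measurable_time measurable_size2.
- exact: measurable_fun_comp2 mc measurable_time measurable_size1.
- exact: measurable_fun_comp2 ma measurable_time measurable_size2.
Qed.

Let sym_ge0 (a c : R * R -> R) (k : R) q : 0 <= k ->
  (forall p, 0 <= a p) -> (forall p, 0 <= c p) -> 0 <= k * sym a c q.
Proof. by move=> k0 a0 c0; rewrite mulr_ge0// addr_ge0// mulr_ge0. Qed.

Let b2_ge0 : 0 <= beta0 + 2. Proof. by rewrite addr_ge0. Qed.

Let gain_ge0 : 0 <= 2 * (beta0 + 2). Proof. by rewrite mulr_ge0. Qed.

Let drift_cst_ge0 (n : nat) : 0 <= 4 * (1 + n%:R) ^+ 2 :> R.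
Proof. by rewrite mulr_ge0// sqr_ge0. Qed.

Lemma measurable_cut_sign n t : measurable_fun setT (cut_sign n t).
Proof.
apply: measurable_funM => //.
by apply: measurableT_comp; [exact: measurable_sgr|exact: mEt].
Qed.

Let cut_sign_norm n t x : `|cut_sign n t x| <= cut n x.
Proof.
rewrite /cut_sign normrM (ger0_norm (cut_ge0 _ _)) normr_sg ler_piMr//.
by case: (_ != 0).
Qed.

(** The two halves of the flux are exchanged by swapping the sizes: the kernel is
    symmetric, and the bound on the gain depends on x + y only. *)
Lemma flux_cut_sign_le n t q : flux (cut_sign n t) q <=
  2 * (beta0 + 2) * sym highS firstE q + 4 * sym firstS (tailS n) q +
  4 * (1 + n%:R) ^+ 2 * sym firstS (drift t) q.
Proof.
have rhs0 : 0 <= 2 * (beta0 + 2) * sym highS firstE q + 4 * sym firstS (tailS n) q +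
    4 * (1 + n%:R) ^+ 2 * sym firstS (drift t) q.
  by rewrite addr_ge0 ?addr_ge0// sym_ge0.
case: q rhs0 => s [x y] rhs0.
have [x0|x0] := ltP 0 x; last first.
  apply: le_trans rhs0.
  by rewrite /flux /= (S_size _ x0) (E_size _ x0) !(mul0r, mulr0, addr0).
have [y0|y0] := ltP 0 y; last first.
  apply: le_trans rhs0.
  by rewrite /flux /= (S_size _ y0) (E_size _ y0) !(mul0r, mulr0, addr0).
pose J := fragments b (cut_sign n t) x y.
have Jle : `|J| <= beta0 + (x + y).
  rewrite -[beta0]mul1r -[x + y]mul1r; apply: fragments_le => //.
  - exact: measurable_cut_sign.
  - by move=> z z0; rewrite mul1r; apply: (le_trans (cut_sign_norm _ _ _)); exact: cut_le1x.
have Jle' : `|J| <= beta0 + (y + x) by rewrite (addrC y).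
have h1 := half_flux n t s x0 y0 Jle.
have h2 := half_flux n t s y0 x0 Jle'.
have -> : flux (cut_sign n t) (s, (x, y)) =
    (J - cut_sign n t x - cut_sign n t y) * sum_kernel alpha beta x y * (S s x * E s y) +
    (J - cut_sign n t y - cut_sign n t x) * sum_kernel alpha beta y x * (S s y * E s x).
  rewrite /flux /rate /= x0 y0/= /zeta -/(fragments b _ x y) -/J (sum_kernelC _ _ y x).
  by ring.
apply: (le_trans (lerD h1 h2)).
rewrite /sym /highS /firstS /firstE /tailS /drift /=.
lra.
Qed.

Let high : R -> \bar R := fun s => (\int[mu]_x (highS (s, x))%:E)%E.
Let first : R -> \bar R := fun s => (\int[mu]_x (firstS (s, x))%:E)%E.
Let dist : R -> \bar R := fun s => (\int[mu]_x (firstE (s, x))%:E)%E.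
Let tail n : R -> \bar R := fun s => (\int[mu]_x (tailS n (s, x))%:E)%E.

Let measurable_high : measurable_fun setT high.
Proof. exact: (measurable_moment (measurable_high_weight beta) mS). Qed.
Let measurable_dist : measurable_fun setT dist.
Proof. exact: (measurable_moment (f := fun s x => `|E s x|) m_1x mabsE). Qed.
Let measurable_tail n : measurable_fun setT (tail n).
Proof. exact: (measurable_moment (measurable_tail_weight n) mS). Qed.

Let high_ge0 s : (0 <= high s)%E.
Proof. by apply: integral_ge0 => x _; rewrite lee_fin. Qed.
Let dist_ge0 s : (0 <= dist s)%E.
Proof. by apply: integral_ge0 => x _; rewrite lee_fin. Qed.
Let tail_ge0 n s : (0 <= tail n s)%E.
Proof. by apply: integral_ge0 => x _; rewrite lee_fin. Qed.

Let dist_le : {ae mu, forall s : R, (dist s <= C%:E)%E}.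
Proof.
apply: ae_sub S_first => s; apply: le_trans.
apply: ge0_le_integral => //.
- by move=> x _; rewrite lee_fin.
- by apply/measurable_EFinP; exact: (measurable_section s measurable_firstE).
- by apply/measurable_EFinP; exact: (measurable_section s measurable_firstS).
- by move=> x _; rewrite lee_fin; exact: (firstE_le (s, x)).
Qed.

Let cut_dist (n : nat) (t : R) : \bar R := (\int[mu]_x (cut n x * `|E t x|)%:E)%E.

Let cut_dist_ge0 n t : (0 <= cut_dist n t)%E.
Proof. by apply: integral_ge0 => x _; rewrite lee_fin mulr_ge0. Qed.

Let cut_dist_fin n t : cut_dist n t \is a fin_num.
Proof.
rewrite ge0_fin_numE//.
apply: (@le_lt_trans _ _ (\int[mu]_x ((1 + n%:R)%:E * (S t x)%:E))%E).
  apply: ge0_le_integral => //.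
  - by move=> x _; rewrite lee_fin mulr_ge0.
  - apply/measurable_EFinP; exact: (measurable_funM (measurable_cut n) (mabsEt _)).
  - by apply/measurable_EFinP; apply: measurable_funM => //; exact: mSt.
  - by move=> x _; rewrite -EFinM lee_fin ler_pM.
rewrite ge0_integralZl//.
- by rewrite lte_mul_pinfty// lee_fin addr_ge0.
- by apply/measurable_EFinP; exact: mSt.
- by move=> x _; rewrite lee_fin.
Qed.

Let source (n : nat) (s : R) : \bar R :=
  ((beta0 + 2)%:E * (high s * dist s) + (2 * C)%:E * tail n s)%E.

Let source_ge0 n s : (0 <= source n s)%E.
Proof. by rewrite adde_ge0// mule_ge0 ?lee_fin ?mule_ge0// mulr_ge0. Qed.

Let measurable_source n : measurable_fun setT (source n).
Proof.
apply: emeasurable_funD; apply: emeasurable_funM => //.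
exact: emeasurable_funM.
Qed.

Let quad (n : nat) : R := 2 * (1 + n%:R) ^+ 2 * C * lip.

Let collect (x1 x2 x3 y2 : \bar R) (k m y3 : R) :
  (0 <= x1)%E -> (0 <= x2)%E -> (0 <= x3)%E -> 0 <= k -> 0 <= m ->
  (x2 <= C%:E * y2)%E -> (x3 <= y3%:E)%E ->
  (4^-1%:E * ((2 * (2 * k))%:E * x1 + (2 * 4)%:E * x2 + (2 * (4 * m))%:E * x3) <=
   k%:E * x1 + (2 * C)%:E * y2 + (2 * m * y3)%:E)%E.
Proof.
move=> x10 x20 x30 k0 m0 x2y x3y.
have c1 : (0 <= (2 * (2 * k))%:E * x1)%E by rewrite mule_ge0// lee_fin !mulr_ge0.
have c2 : (0 <= (2 * 4)%:E * x2)%E by rewrite mule_ge0// lee_fin.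
have c3 : (0 <= (2 * (4 * m))%:E * x3)%E by rewrite mule_ge0// lee_fin !mulr_ge0.
rewrite ge0_muleDr ?adde_ge0// ge0_muleDr// !muleA -!EFinM.
have -> : 4^-1 * (2 * (2 * k)) = k by field.
have -> : 4^-1 * (2 * 4) = 2 :> R by field.
have -> : 4^-1 * (2 * (4 * m)) = 2 * m by field.
apply: leeD; first apply: leeD => //.
  by rewrite EFinM -muleA lee_wpmul2l// lee_fin.
by rewrite [leRHS]EFinM lee_wpmul2l// lee_fin mulr_ge0.
Qed.

Let integral_source n (D : set R) : measurable D ->
  (\int[mu]_(s in D) source n s = (beta0 + 2)%:E * \int[mu]_(s in D) (high s * dist s) +
   (2 * C)%:E * \int[mu]_(s in D) tail n s)%E.
Proof.
move=> mD.
have mc k f : measurable_fun setT f -> measurable_fun setT (fun s : R => k%:E * f s)%E.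
  by move=> mf; apply: emeasurable_funM.
have mhd : measurable_fun setT (fun s => high s * dist s)%E by exact: emeasurable_funM.
rewrite ge0_integralD//; first last.
- by apply: measurable_funTS; apply: mc; exact: measurable_tail.
- by move=> s _; rewrite mule_ge0// lee_fin mulr_ge0.
- by apply: measurable_funTS; exact: mc.
- by move=> s _; rewrite mule_ge0 ?lee_fin// mule_ge0.
rewrite !ge0_integralZl//.
- by apply: measurable_funTS; exact: measurable_tail.
- by rewrite lee_fin mulr_ge0.
- exact: measurable_funTS mhd.
- by move=> s _; exact: mule_ge0.
Qed.

(** On [r, t] the drift E(t) - E(s) has norm at most lip (t - s), which turns the
    last term of the bound on the flux into a quadratic error. *)
Lemma cut_dist_increment n (r t : R) : 0 <= r -> r <= t -> t < T ->
  (cut_dist n t <= cut_dist n r + (\int[mu]_(s in slice r t) source n s +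
     (quad n * (t - r) ^+ 2)%:E))%E.
Proof.
move=> r0 rt tT.
have mphi := measurable_cut_sign n t.
have phic x : `|cut_sign n t x| <= 1 + n%:R by exact: le_trans (cut_sign_norm _ _ _) (cut_le n x).
have -> : cut_dist n t = (\int[mu]_x (cut_sign n t x * E t x)%:E)%E.
  by apply: eq_integral => x _; rewrite /cut_sign -mulrA -normrEsg.
have mD := measurable_slice r t.
apply: (@le_trans _ _ (\int[mu]_x (cut_sign n t x * E r x)%:E +
    (\int[mu]_(s in slice r t) source n s + (quad n * (t - r) ^+ 2)%:E))%E); last first.
  apply: leeD2r; apply: le_integral_ge0 => //.
  - apply/measurable_EFinP; apply: measurable_funM => //; exact: mEt.
  - apply/measurable_EFinP; exact: (measurable_funM (measurable_cut n) (mabsEt _)).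
  - by move=> x _; rewrite lee_fin mulr_ge0.
  - move=> x _; rewrite lee_fin; apply: (le_trans (ler_norm _)).
    by rewrite normrM ler_wpM2r.
apply: (le_pairing r0 rt tT mphi phic).
apply: (@le_trans _ _ (4^-1%:E * \int[mu \x leb2]_(q in slice r t `*` setT)
   ((2 * (beta0 + 2) * sym highS firstE q)%:E + (4 * sym firstS (tailS n) q)%:E +
    (4 * (1 + n%:R) ^+ 2 * sym firstS (drift t) q)%:E))%E).
  apply: lee_wpmul2l; first by rewrite lee_fin.
  have mDT : measurable (slice r t `*` [set: R * R]) by exact: measurableX.
  apply: le_integral_ge0 => //.
  - by apply: measurable_funTS; apply/measurable_EFinP; exact: measurable_flux.
  - by apply: measurable_funTS; apply: emeasurable_funD; [apply: emeasurable_funD|];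
      apply: measurable_sym.
  - by move=> q _; rewrite -!EFinD lee_fin addr_ge0 ?addr_ge0// sym_ge0.
  - by move=> q _; rewrite -!EFinD lee_fin; exact: flux_cut_sign_le.
have mDT : measurable (slice r t `*` [set: R * R]) by exact: measurableX.
rewrite ge0_integralD//; first last.
- by apply: measurable_funTS; exact: measurable_sym.
- by move=> q _; rewrite lee_fin sym_ge0.
- by apply: measurable_funTS; apply: emeasurable_funD; exact: measurable_sym.
- by move=> q _; rewrite -EFinD lee_fin addr_ge0// sym_ge0.
rewrite ge0_integralD//; first last.
- by apply: measurable_funTS; exact: measurable_sym.
- by move=> q _; rewrite lee_fin sym_ge0.
- by apply: measurable_funTS; exact: measurable_sym.
- by move=> q _; rewrite lee_fin sym_ge0.
rewrite !integral_slab_symM//.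
rewrite -/high -/first -/dist.
have I1 : (0 <= \int[mu]_(s in slice r t) (high s * dist s))%E.
  by apply: integral_ge0 => s _; exact: mule_ge0.
have first0 s : (0 <= first s)%E.
  by apply: integral_ge0 => x _; rewrite lee_fin.
have I2 : (\int[mu]_(s in slice r t) (first s * tail n s) <=
    C%:E * \int[mu]_(s in slice r t) tail n s)%E.
  exact: first_slab.
pose h s : \bar R := (\int[mu]_x (drift t (s, x))%:E)%E.
have mh : measurable_fun setT h.
  apply: (@measurable_partial_integral _ _ _ _ _ mu (fun p => (drift t p)%:E)).
  by apply/measurable_EFinP; exact: measurable_drift.
have h0 s : (0 <= h s)%E by apply: integral_ge0 => x _; rewrite lee_fin.
have I3 : (\int[mu]_(s in slice r t) (first s * h s) <=
    (C * lip * (t - r) ^+ 2)%:E)%E.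
  apply: (le_trans (first_slab mD mh h0)).
  rewrite -mulrA EFinM lee_wpmul2l//.
  apply: (@le_trans _ _ (\int[mu]_(s in slice r t) (lip * (t - r))%:E)%E).
    apply: ge0_le_integral => //; first exact: (measurable_funS _ _ mh).
    move=> s [/=]; rewrite !in_itv/= => /andP[s0 st] /negP; rewrite s0/= -leNgt => rs.
    apply: (le_trans (lipschitz_L1 (ltW s0) (ltW st) tT)).
    by rewrite lee_fin ler_wpM2l// lerD2l lerN2.
  rewrite integral_cst// expr2 mulrA [leRHS]EFinM lee_wpmul2l ?mu_slice//.
  by rewrite lee_fin mulr_ge0// subr_ge0.
rewrite integral_source//.
have X2 : (0 <= \int[mu]_(s in slice r t) (first s * tail n s))%E.
  by apply: integral_ge0 => s _; exact: mule_ge0.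
have X3 : (0 <= \int[mu]_(s in slice r t) (first s * h s))%E.
  by apply: integral_ge0 => s _; exact: mule_ge0.
have -> : quad n * (t - r) ^+ 2 = 2 * (1 + n%:R) ^+ 2 * (C * lip * (t - r) ^+ 2).
  by rewrite /quad; ring.
exact: (collect I1 X2 X3 b2_ge0 (sqr_ge0 _) I2 I3).
Qed.

Let high_fin : (\int[mu]_s high s < +oo)%E.
Proof. exact: S_high. Qed.

Let on_half (f : R -> \bar R) (D : set R) : measurable D -> measurable_fun setT f ->
  (forall s, 0 <= f s)%E -> (\int[mu]_(s in D) f s <= \int[mu]_s f s)%E.
Proof. by move=> mD mf f0; apply: ge0_subset_integral. Qed.

Let tail_le n s : (tail n s <= high s)%E.
Proof.
apply: ge0_le_integral => //.
- by move=> x _; rewrite lee_fin.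
- by apply/measurable_EFinP; exact: (measurable_section s (measurable_tailS n)).
- by apply/measurable_EFinP; exact: (measurable_section s measurable_highS).
- move=> x _; rewrite lee_fin ler_wpM2r// /tail_weight.
  by case: ifPn => // _; exact: high_weight_ge0.
Qed.

Let high_dist_fin (D : set R) : measurable D ->
  (\int[mu]_(s in D) (high s * dist s) < +oo)%E.
Proof.
move=> mD; apply: (@le_lt_trans _ _ (\int[mu]_(s in D) (C%:E * high s))%E).
  apply: ae_ge0_le_integral => //.
  - by move=> s _; exact: mule_ge0.
  - by apply: measurable_funTS; exact: emeasurable_funM.
  - by move=> s _; rewrite mule_ge0// lee_fin.
  - by apply: measurable_funTS; apply: emeasurable_funM.
  - by apply: ae_sub dist_le => s ds _; rewrite muleC lee_wpmul2r.
rewrite ge0_integralZl//; last exact: measurable_funTS.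
apply: lte_mul_pinfty => //; apply: le_lt_trans high_fin.
exact: on_half.
Qed.

Let tail_fin n (D : set R) : measurable D -> (\int[mu]_(s in D) tail n s < +oo)%E.
Proof.
move=> mD; apply: le_lt_trans high_fin; apply: (@le_trans _ _ (\int[mu]_s tail n s)%E).
  exact: on_half.
by apply: ge0_le_integral => //; exact: measurable_tail.
Qed.

Let source_fin n (D : set R) : measurable D ->
  (\int[mu]_(s in D) source n s)%E \is a fin_num.
Proof.
move=> mD; rewrite ge0_fin_numE; last exact: integral_ge0.
rewrite integral_source// lte_add_pinfty//.
  by apply: lte_mul_pinfty => //; exact: high_dist_fin.
by apply: lte_mul_pinfty; [rewrite lee_fin mulr_ge0| |exact: tail_fin].
Qed.

(** The quadratic errors disappear although their constant depends on n. *)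
Lemma cut_dist_le_source n (t : R) : 0 <= t -> t < T ->
  (cut_dist n t <= \int[mu]_(s in `]0%R, t[) source n s)%E.
Proof.
move=> t0 tT.
pose V r := fine (\int[mu]_(s in `]0%R, r[) source n s)%E.
have mI (r : R) : measurable `]0, r[%classic by exact: measurable_itv.
have := @le_of_quadratic_increments _ (fun r => fine (cut_dist n r)) V t (quad n) t0.
have -> : fine (cut_dist n 0) = 0.
  rewrite /cut_dist integral0_eq// => x _.
  have -> : E 0 x = 0.
    by have := ES 0 x; rewrite S_time ?ltxx// normr_le0 => /eqP.
  by rewrite normr0 mulr0.
have -> : V 0 = 0 by rewrite /V set_itv_ge ?integral_set0// bnd_simp ltxx.
rewrite !subr0 => H.
rewrite -(fineK (cut_dist_fin n t)) -(fineK (source_fin n (mI t))) lee_fin; apply: H.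
move=> r u r0 ru ut.
have mD := measurable_slice r u.
have := cut_dist_increment n r0 ru (le_lt_trans ut tT).
rewrite -(fineK (cut_dist_fin n u)) -(fineK (cut_dist_fin n r)).
rewrite -(fineK (source_fin n mD)) -!EFinD lee_fin.
have -> : V u = V r + fine (\int[mu]_(s in slice r u) source n s)%E.
  rewrite /V -fineD ?source_fin//; congr fine.
  have sub : `]0, r[%classic `<=` `]0, u[%classic.
    by apply: subset_itvl; rewrite bnd_simp.
  rewrite -ge0_integral_setU//; first by rewrite /slice setDUK.
  - by apply: measurable_funTS; exact: measurable_source.
  - by rewrite disj_set2E /slice setDIK.
by lra.
Qed.

Lemma tail_cvg0 : (\int[mu]_s tail n s @[n --> \oo] --> 0)%E.
Proof.
have ihigh : leb2.-integrable setT (fun p => (highS p)%:E).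
  apply/integrableP; split; first exact/measurable_EFinP.
  under eq_integral do rewrite gee0_abs ?lee_fin//.
  rewrite (fubini_tonelli1 (m1 := mu) (m2 := mu)).
  - exact: S_high.
  - exact/measurable_EFinP.
  - by move=> p; rewrite lee_fin.
have msize : measurable_fun setT (fun p : R * R => p.2%:E).
  by apply/measurable_EFinP; exact: measurable_snd.
have hfin : {ae leb2, forall p : R * R, setT p -> (p.2%:E < +oo)%E}.
  apply: (@aeW _ _ _ leb2) => p _; exact: ltry.
have := integral_tail_cvg0 measurableT ihigh (fun p _ => highS_ge0 p : (0 <= _%:E)%E) msize hfin.
apply: cvg_trans; apply: near_eq_cvg; apply: nearW => n.
have -> : (\int[mu]_s tail n s = \int[leb2]_p (tailS n p)%:E)%E.
  rewrite (fubini_tonelli1 (m1 := mu) (m2 := mu))//.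
  - by apply/measurable_EFinP; exact: measurable_tailS.
  - by move=> p; rewrite lee_fin.
rewrite integral_mkcondr; apply: eq_integral => p _.
rewrite /patch /tailS /tail_weight; case: ifPn.
  by rewrite inE /= lte_fin => ->.
by rewrite notin_setE /= lte_fin => /negP/negbTE->; rewrite mul0r.
Qed.

(** For k >= n the distance cut off at n is at most the one cut off at k, whose tail
    term vanishes as k goes to infinity; monotone convergence in n then restores the
    full weight. *)
Lemma dist_le_integral (t : R) : 0 <= t -> t < T ->
  (dist t <= \int[mu]_(s in `]0%R, t[) ((beta0 + 2)%:E * high s * dist s))%E.
Proof.
move=> t0 tT.
have mI : measurable `]0, t[%classic by exact: measurable_itv.
have mhd : measurable_fun setT (fun s => high s * dist s)%E by exact: emeasurable_funM.
have -> : (\int[mu]_(s in `]0%R, t[) ((beta0 + 2)%:E * high s * dist s) =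
    (beta0 + 2)%:E * \int[mu]_(s in `]0%R, t[) (high s * dist s))%E.
  under eq_integral do rewrite -muleA.
  rewrite ge0_integralZl//; first exact: measurable_funTS mhd.
  by move=> s _; exact: mule_ge0.
set X := (_ * _)%E.
have cut_mono (m n : nat) : (m <= n)%N -> forall x, cut m x * `|E t x| <= cut n x * `|E t x|.
  move=> mn x; rewrite ler_wpM2r// /cut; case: ltP => //= x0.
  case: (leP x m%:R) => [xm|_]; last by case: ifPn => // _; exact: x1_ge0.
  by rewrite (le_trans xm)// ler_nat.
have cutX n : (cut_dist n t <= X)%E.
  have tail0 : (X + (2 * C)%:E * \int[mu]_s tail k s @[k --> \oo] --> X)%E.
    rewrite -[X in _ --> X]adde0; apply: cvgeD; first by rewrite fin_num_adde_defl.
      exact: cvg_cst.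
    by rewrite -(mule0 (2 * C)%:E); apply: cvgeZl => //; exact: tail_cvg0.
  rewrite -(cvg_lim _ tail0)//.
  apply: lime_ge; first by apply/cvg_ex; exists X.
  near=> k; have nk : (n <= k)%N by near: k; exact: nbhs_infty_ge.
  apply: (@le_trans _ _ (cut_dist k t)).
    apply: ge0_le_integral => //.
    - by move=> x _; rewrite lee_fin mulr_ge0.
    - by apply/measurable_EFinP; exact: (measurable_funM (measurable_cut n) (mabsEt _)).
    - by apply/measurable_EFinP; exact: (measurable_funM (measurable_cut k) (mabsEt _)).
    - by move=> x _; rewrite lee_fin; exact: cut_mono.
  apply: (le_trans (cut_dist_le_source k t0 tT)); rewrite integral_source//.
  apply: leeD2l; apply: lee_wpmul2l; first by rewrite lee_fin mulr_ge0.
  by apply: on_half => //; exact: measurable_tail.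
have cut_cvg : (cut_dist n t @[n --> \oo] --> dist t)%E.
  have := @cvg_monotone_convergence _ _ _ mu setT measurableT
    (fun n x => (cut n x * `|E t x|)%:E).
  move=> /(_ _ _ _)/cvg_trans H.
  have -> : dist t = (\int[mu]_x limn (fun n => (cut n x * `|E t x|)%:E))%E.
    apply: eq_integral => x _; apply/esym/cvg_lim => //; apply: cvg_near_cst.
    near=> n; congr (_%:E); rewrite /firstE /=.
    have [x0|x0] := ltP 0 x; last by rewrite E_size// normr0 !mulr0.
    rewrite /cut x0/= ifT//; near: n; exact: nbhs_infty_ger.
  apply: H => //.
  - by move=> n; apply/measurable_EFinP; exact: (measurable_funM (measurable_cut n) (mabsEt _)).
  - by move=> n x _; rewrite lee_fin mulr_ge0.
  - by move=> x _ m n mn; rewrite lee_fin; exact: cut_mono.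
rewrite -(cvg_lim _ cut_cvg)//; apply: lime_le; first by apply/cvg_ex; exists (dist t).
by apply: nearW.
Unshelve. all: by end_near. Qed.

Lemma difference_eq0 (t : R) : 0 < t < T ->
  (\int[mu]_x ((1 + x) * `|E t x|)%:E = 0)%E.
Proof.
move: t; change (forall t, 0 < t < T -> dist t = 0%E).
apply: (@gronwall_zero _ dist (fun s => (beta0 + 2)%:E * high s)%E T C) => //.
- by apply: emeasurable_funM.
- by move=> s; rewrite mule_ge0// lee_fin.
- rewrite ge0_integralZl//; last exact: measurable_funTS.
  by apply: lte_mul_pinfty => //; apply: le_lt_trans high_fin; exact: on_half.
- by apply: ae_sub dist_le => s.
- by move=> s /andP[/ltW s0 sT]; exact: dist_le_integral.
Qed.

End Difference.

(** * Iterated integrals *)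

Section Iterated.
Context {R : realType}.
Local Notation mu := (@lebesgue_measure R).

Lemma ae_integral_eq0 (f : R -> \bar R) : measurable_fun setT f ->
  {ae mu, forall x, f x = 0%E} -> (\int[mu]_x f x = 0)%E.
Proof.
move=> mf f0; rewrite (ae_eq_integral (cst 0%E))//; first by rewrite integral0.
by apply: ae_sub f0 => x fx _.
Qed.

Lemma ae_eq0_of_integral (D : set R) (h : R -> R) : measurable D ->
  measurable_fun D h -> (\int[mu]_(x in D) `|(h x)%:E| = 0)%E ->
  {ae mu, forall x, D x -> h x = 0}.
Proof.
move=> mD /measurable_EFinP mh h0.
have /(_ h0) := (ae_eq_integral_abs mu mD mh).1.
by apply: ae_sub => x /[apply] -[].
Qed.

Lemma Rintegral_iterated2 (k : R * R -> R) : leb2.-integrable setT (EFin \o k) ->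
  \int[mu]_x \int[mu]_y k (x, y) = fine (\int[leb2]_p (k p)%:E)%E.
Proof.
move=> ik; rewrite -(integral12_prod_meas1 ik) {1}/Rintegral; congr fine.
have mk := measurable_fubini_F ik.
apply: ae_eq_integral => //.
- apply/measurable_EFinP; exact: measurableT_comp (fine_measurable measurableT) mk.
- apply: ae_sub (ae_integrable1 ik) => x ikx _.
  by rewrite /Rintegral /= fineK// integrable_fin_num.
Qed.

(** The real-valued integral replaces infinite inner integrals by 0.  For an
    integrable function this changes the inner integrals on a null set only, but
    the values on that set still have to be measurable in the outer variable. *)
Lemma Rintegral_iterated3 (k : R * (R * R) -> R) :
  (mu \x leb2)%E.-integrable setT (EFin \o k) ->
  \int[mu]_s \int[mu]_x \int[mu]_y k (s, (x, y)) =
  fine (\int[mu \x leb2]_q (k q)%:E)%E.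
Proof.
move=> ik; rewrite -(integral12_prod_meas1 ik) {1}/Rintegral; congr fine.
have mk : measurable_fun setT (EFin \o k) := measurable_int _ ik.
pose in2 (s : R) (x : R) := \int[mu]_y k (s, (x, y)).
have m_in2 : measurable_fun setT (fun p : R * R => in2 p.1 p.2).
  apply: measurableT_comp; first exact: fine_measurable.
  apply: (@measurable_partial_integral _ _ _ _ _ mu
    (fun p : (R * R) * R => (k (p.1.1, (p.1.2, p.2)))%:E)).
  apply: (measurableT_comp mk); apply: measurable_fun_pair.
    by apply: measurableT_comp.
  by apply: measurable_fun_pair => //; exact: measurableT_comp.
apply: ae_eq_integral => //.
- apply/measurable_EFinP; apply: measurableT_comp; first exact: fine_measurable.
  apply: (@measurable_partial_integral _ _ _ _ _ mu (fun p => (in2 p.1 p.2)%:E)).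
  exact/measurable_EFinP.
- exact: (measurable_fubini_F ik).
- apply: ae_sub (ae_integrable1 ik) => s iks _.
  by rewrite (Rintegral_iterated2 iks) fineK// integrable_fin_num.
Qed.

Lemma null_prod3 (N : set (R * (R * R))) : measurable N ->
  (forall s, {ae mu, forall x, {ae mu, forall y, ~ N (s, (x, y))}}) ->
  (mu \x leb2)%E N = 0%E.
Proof.
move=> mN Nae; apply: integral0_eq => s _ /=.
have mNs : measurable (xsection N s) by exact: measurable_xsection.
apply: (ae_integral_eq0 (f := mu \o xsection (xsection N s))).
  exact: measurable_fun_xsection.
apply: ae_sub (Nae s) => x Nx /=.
have mNsx : measurable (xsection (xsection N s) x) by exact: measurable_xsection.
apply/negligibleP => //; apply: negligibleS Nx => y.
by rewrite /xsection /= !inE /= inE => Nq; apply.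
Qed.

End Iterated.

(** * From weak solutions to their absolute values *)

Definition zero_ext {R : realType} (h : R -> R) (x : R) : R := if 0 < x then h x else 0.

Section Solution.
Context {R : realType}.
Local Notation mu := (@lebesgue_measure R).
Local Notation Rpos := (halfline R).
Context (alpha beta : R).
Hypotheses (halpha : 0 <= alpha) (hab : alpha <= beta) (hbeta : beta <= 1).
Context (b : R -> R -> R -> R) (beta0 : R).
Hypothesis hb : daughter_distribution b.
Hypothesis hmass : forall x y : R, 0 < x -> 0 < y ->
  (\int[mu]_(z in `]0%R, (x + y)%R[) (z * b z x y)%:E = (x + y)%:E)%E.
Hypothesis hbeta0 : 0 <= beta0.
Hypothesis hnumber : forall x y : R, 0 < x -> 0 < y ->
  (\int[mu]_(z in `]0%R, (x + y)%R[) (b z x y)%:E <= beta0%:E)%E.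
Context (fin : R -> R) (T : \bar R) (f : R -> R -> R).
Hypothesis hfin0 : X 0 fin.
Hypothesis hf : weak_solution (sum_kernel alpha beta) b fin T f.
Hypothesis hMf : forall t : R, itv_oo T t ->
  mu.-integrable `]0, t[%classic (fun s => M (1 + beta) (f s)).
Context (t0 : R).
Hypothesis t0T : itv_oo T t0.

Let t0_gt0 : 0 < t0. Proof. by case: t0T. Qed.

Lemma itv_oo_co (T' : \bar R) t : itv_oo T' t -> itv_co T' t.
Proof. by case=> /ltW. Qed.

Let before (s : R) : 0 < s <= t0 -> itv_oo T s.
Proof.
move=> /andP[s0 st]; split => //; apply: le_lt_trans t0T.2; by rewrite lee_fin.
Qed.

Definition abs_ext (s x : R) : R := if (0 < s < t0) && (0 < x) then `|f s x| else 0.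

Lemma X0_integrable (h : R -> R) : X 0 h -> mu.-integrable Rpos (EFin \o h).
Proof.
by apply: eq_integrable => [|x _]; [exact: measurable_halfline|rewrite powRr0 mul1r].
Qed.

Let integrable_f s : itv_co T s -> mu.-integrable Rpos (EFin \o f s).
Proof. by move=> sT; apply: X0_integrable; exact: (ws_continuous hf).1. Qed.

Let measurable_f s : itv_co T s -> measurable_fun Rpos (f s).
Proof. by move=> sT; apply/measurable_EFinP; exact: measurable_int (integrable_f sT). Qed.

Let RposE (x : R) : Rpos x <-> 0 < x.
Proof. by rewrite /halfline /= in_itv/= andbT. Qed.

Lemma abs_ext_ge0 s x : 0 <= abs_ext s x.
Proof. by rewrite /abs_ext; case: ifP. Qed.

Lemma abs_ext_size s x : x <= 0 -> abs_ext s x = 0.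
Proof. by move=> x0; rewrite /abs_ext [0 < x]ltNge x0 andbF. Qed.

Lemma abs_ext_time s x : ~~ (0 < s < t0) -> abs_ext s x = 0.
Proof. by rewrite /abs_ext => /negbTE->. Qed.

Let D3 : set (R * (R * R)) := `]0, t0[%classic `*` (Rpos `*` Rpos).

Let mD3 : measurable D3.
Proof. by do 2 (apply: measurableX => //); exact: measurable_halfline. Qed.

Let coll : R * (R * R) -> R :=
  (fun p => sum_kernel alpha beta p.2.1 p.2.2 * f p.1 p.2.1 * f p.1 p.2.2) \_ D3.

Let integrable_coll : (mu \x leb2)%E.-integrable setT (EFin \o coll).
Proof.
have I : (mu \x leb2)%E.-integrable D3 (fun p => (sum_kernel alpha beta p.2.1 p.2.2 *
    f p.1 p.2.1 * f p.1 p.2.2)%:E) by exact: (ws_integrable hf t0T).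
have {}I := (@integrable_mkcond _ _ _ (mu \x leb2)%E _ _ mD3).1 I.
move: I; apply: eq_integrable => // q _; rewrite /coll /patch /=.
by case: ifPn.
Qed.

Let measurable_coll : measurable_fun setT coll.
Proof. by apply/measurable_EFinP; exact: measurable_int integrable_coll. Qed.

Lemma sum_kernel_gt0 x : 0 < x -> 0 < sum_kernel alpha beta x x.
Proof. by move=> x0; rewrite addr_gt0// mulr_gt0// powR_gt0. Qed.

(** Only the collision term K(x,y) f(s,x) f(s,y) is known to be jointly measurable;
    on the diagonal, divided by K(x,x) > 0, it is f(s,x)^2, whose root is |f|. *)
Lemma measurable_abs_ext : measurable_fun setT (fun p : R * R => abs_ext p.1 p.2).
Proof.
apply: (eq_measurable_fun (fun p : R * R => (coll (p.1, (p.2, p.2)) *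
    sum_kernel alpha beta p.2 p.2 `^ (- 1)) `^ 2^-1)).
  move=> [s x] _ /=; rewrite /abs_ext /coll /patch.
  case: ifPn => [|]; [rewrite inE|rewrite notin_setE] => sxD.
    case: sxD => /=; rewrite in_itv/= => /andP[s0 st] [/RposE x0 _].
    rewrite s0 st x0/= powR_inv1 ?ltW ?sum_kernel_gt0//.
    have K0 : sum_kernel alpha beta x x != 0 by rewrite gt_eqF// sum_kernel_gt0.
    rewrite (_ : _ / _ = f s x ^+ 2); last by field.
    by rewrite powR12_sqrt ?sqr_ge0// sqrtr_sqr.
  rewrite mul0r powR0 ?invr_neq0//; case: ifP => // /andP[st x0]; case: sxD.
  by split; rewrite /= ?in_itv//; split; apply/RposE.
apply: (measurableT_comp (measurable_powR _)); apply: measurable_funM.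
  apply: (measurableT_comp measurable_coll); apply: measurable_fun_pair => //.
  exact: measurable_fun_pair.
apply: (measurableT_comp (measurable_powR _)).
by apply: measurable_funD; apply: measurable_funM;
  apply: (measurableT_comp (measurable_powR _)).
Qed.

Let ae_f s : itv_co T s -> {ae mu, forall x, 0 < x -> `|f s x| = f s x}.
Proof.
move=> sT; apply: ae_sub (ws_nonneg hf sT) => x fx x0.
by rewrite ger0_norm// fx//; exact/RposE.
Qed.

Let integral_abs_ext (w : R -> R) (s : R) : 0 < s < t0 ->
  (\int[mu]_x (w x * abs_ext s x)%:E = \int[mu]_(x in Rpos) (w x * `|f s x|)%:E)%E.
Proof.
move=> st; rewrite [RHS]integral_mkcond; apply: eq_integral => x _.
rewrite /abs_ext st /patch/=; case: ifPn => [x0|].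
  by rewrite mem_set//; exact/RposE.
move=> x0; rewrite mulr0; case: ifPn => //; rewrite inE => /RposE.
by rewrite (negbTE x0).
Qed.

Let integral_absf (w : R -> R) (s : R) : itv_co T s -> measurable_fun setT w ->
  (\int[mu]_(x in Rpos) (w x * `|f s x|)%:E = \int[mu]_(x in Rpos) (w x * f s x)%:E)%E.
Proof.
move=> sT mw; have mf := measurable_f sT.
have mw' : measurable_fun Rpos w by exact: measurable_funTS.
apply: ae_eq_integral; first exact: measurable_halfline.
- apply/measurable_EFinP; apply: measurable_funM => //; exact: measurableT_comp.
- by apply/measurable_EFinP; exact: measurable_funM.
- by apply: ae_sub (ae_f sT) => x fx /RposE x0; rewrite fx.
Qed.

(** Weak continuity tested with the constant 1, on a compact time interval. *)
Lemma abs_ext_L1_bound : exists2 B : R, 0 <= B &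
  forall s, (\int[mu]_x (abs_ext s x)%:E <= B%:E)%E.
Proof.
pose m s := \int[mu]_(x in Rpos) (1 * f s x).
have L1 : Linfty (cst 1 : R -> R).
  split => //; exists 1; apply: ae_all => x _; by rewrite normr1.
have cm : {within `[0, t0], continuous m}.
  apply: continuous_subspaceW ((ws_continuous hf).2 _ L1) => s /=.
  rewrite in_itv/= => /andP[s0 st]; split => //.
  by apply: le_lt_trans t0T.2; rewrite lee_fin.
have [c _ mc] := EVT_max (ltW t0_gt0) cm.
exists (Num.max (m c) 0); first by rewrite le_max lexx orbT.
move=> s; have [st|st] := boolP (0 < s < t0); last first.
  rewrite integral0_eq ?lee_fin ?le_max ?lexx ?orbT// => x _.
  by rewrite abs_ext_time.
have sT : itv_co T s.
  by apply: itv_oo_co; apply: before; case/andP: st => -> /ltW.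
have -> : (\int[mu]_x (abs_ext s x)%:E = \int[mu]_(x in Rpos) (1 * f s x)%:E)%E.
  rewrite -(integral_absf (w := cst 1) sT)// -(integral_abs_ext (cst 1) st).
  by apply: eq_integral => x _; rewrite mul1r.
have if1 : mu.-integrable Rpos (fun x => (1 * f s x)%:E).
  by under eq_fun do rewrite mul1r; exact: integrable_f.
rewrite -[leLHS]fineK; last first.
  by apply: integrable_fin_num => //; exact: measurable_halfline.
rewrite lee_fin le_max; apply/orP; left; apply: mc.
by case/andP: st => s0 st; rewrite in_itv/= (ltW s0) (ltW st).
Qed.

Let mabs (s : R) : measurable_fun setT (abs_ext s).
Proof. exact: (measurable_section s measurable_abs_ext). Qed.

Let mx_abs (w : R -> R) (s : R) : measurable_fun setT w ->
  measurable_fun setT (fun x => (w x * abs_ext s x)%:E).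
Proof. by move=> mw; apply/measurable_EFinP; exact: (measurable_funM mw (mabs s)). Qed.

Lemma abs_ext_first_bound : exists2 C : R, 0 <= C &
  {ae mu, forall s : R, (\int[mu]_x ((1 + x) * abs_ext s x)%:E <= C%:E)%E}.
Proof.
have [B B0 HB] := abs_ext_L1_bound.
have [_ _ [C1 HC1]] := ws_bounded hf.
have C10 : 0 <= Num.max C1 0 by rewrite le_max lexx orbT.
exists (B + Num.max C1 0); first exact: addr_ge0.
apply: ae_sub HC1 => s Xs.
have [st|st] := boolP (0 < s < t0); last first.
  rewrite integral0_eq ?lee_fin ?addr_ge0// => x _.
  by rewrite abs_ext_time// mulr0.
have sT : itv_oo T s by apply: before; case/andP: st => -> /ltW.
have -> : (\int[mu]_x ((1 + x) * abs_ext s x)%:E =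
    \int[mu]_x (abs_ext s x)%:E + \int[mu]_x (x * abs_ext s x)%:E)%E.
  rewrite -ge0_integralD//.
  - by apply: eq_integral => x _; rewrite -EFinD mulrDl mul1r.
  - by move=> x _; rewrite lee_fin abs_ext_ge0.
  - by apply/measurable_EFinP; exact: mabs.
  - move=> x _; rewrite lee_fin; have [x0|x0] := ltP 0 x.
      by rewrite mulr_ge0 ?abs_ext_ge0// ltW.
    by rewrite abs_ext_size// mulr0.
  - exact: mx_abs.
rewrite EFinD; apply: leeD; first exact: HB.
rewrite (integral_abs_ext id st); apply: (@le_trans _ _ C1%:E); last first.
  by rewrite lee_fin le_max lexx.
have := Xs sT; rewrite /Xnorm; apply: le_trans.
rewrite le_eqVlt; apply/orP; left; apply/eqP; apply: eq_integral => x.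
by rewrite inE => /RposE x0; rewrite powRr1// ltW.
Qed.

Lemma abs_ext_high_fin :
  (\int[mu]_s \int[mu]_x (high_weight beta x * abs_ext s x)%:E < +oo)%E.
Proof.
have [B B0 HB] := abs_ext_L1_bound.
pose D := `]0, t0[%classic.
have mD : measurable D by exact: measurable_itv.
have mw : measurable_fun setT (fun x : R => x `^ (1 + beta)) by exact: measurable_powR.
pose h s := (\int[mu]_x (high_weight beta x * abs_ext s x)%:E)%E.
have h0 s : (0 <= h s)%E.
  by apply: integral_ge0 => x _; rewrite lee_fin mulr_ge0 ?abs_ext_ge0 ?high_weight_ge0.
have mh : measurable_fun setT h.
  apply: (@measurable_partial_integral _ _ _ _ _ mu
    (fun p => (high_weight beta p.2 * abs_ext p.1 p.2)%:E)).
  apply/measurable_EFinP; apply: measurable_funM; last exact: measurable_abs_ext.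
  by apply: measurableT_comp => //; exact: measurable_high_weight.
have -> : (\int[mu]_s h s = \int[mu]_(s in D) h s)%E.
  rewrite [RHS]integral_mkcond; apply: eq_integral => s _.
  rewrite /patch; case: ifPn => // sD; apply: integral0_eq => x _.
  rewrite abs_ext_time ?mulr0//; apply: contra sD => sD.
  by rewrite inE /D /= in_itv/=.
have iM := hMf t0T.
apply: (@le_lt_trans _ _ (\int[mu]_(s in D) (B%:E + `|M (1 + beta) (f s)|))%E).
  apply: ge0_le_integral => //.
  - exact: measurable_funTS.
  - apply: emeasurable_funD => //; apply: measurableT_comp => //.
    exact: measurable_int iM.
  - move=> s; rewrite /D /= in_itv/= => st.
    have sT : itv_oo T s by apply: before; case/andP: st => -> /ltW.
    have -> : h s = (\int[mu]_x (abs_ext s x)%:E +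
        \int[mu]_x (x `^ (1 + beta) * abs_ext s x)%:E)%E.
      rewrite -ge0_integralD//.
      - by apply: eq_integral => x _; rewrite -EFinD /high_weight mulrDl mul1r.
      - by move=> x _; rewrite lee_fin abs_ext_ge0.
      - by apply/measurable_EFinP; exact: mabs.
      - by move=> x _; rewrite lee_fin mulr_ge0 ?abs_ext_ge0 ?powR_ge0.
      - exact: mx_abs.
    apply: leeD; first exact: HB.
    rewrite (integral_abs_ext (fun x => x `^ (1 + beta)) st).
    by rewrite (integral_absf (itv_oo_co sT))// lee_abs.
rewrite ge0_integralD//; first last.
- by apply: measurableT_comp => //; exact: measurable_int iM.
apply: lte_add_pinfty; last by have /integrableP[] := iM.
rewrite integral_cst//; apply: lte_mul_pinfty => //.
have : (mu `]0%R, t0[%classic < +oo)%E; last by [].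
by rewrite lebesgue_measure_itv/=; case: ifPn => _; rewrite ?ltry.
Qed.

Let rate_ff (phi : R -> R) (t : R) (q : R * (R * R)) : R :=
  if 0 < q.1 < t then
    (if (0 < q.2.1) && (0 < q.2.2) then zeta b phi q.2.1 q.2.2 else 0) * coll q
  else 0.

Let rate_FF (phi : R -> R) (t : R) (q : R * (R * R)) : R :=
  if 0 < q.1 < t then
    rate alpha beta b phi q.2 * (abs_ext q.1 q.2.1 * abs_ext q.1 q.2.2)
  else 0.

Let measurable_window (t : R) : measurable_fun setT (fun q : R * (R * R) => 0 < q.1 < t).
Proof.
by apply: measurable_and; apply: measurable_fun_ltr => //; exact: measurable_fst.
Qed.

Let integrable_rate_ff (phi : R -> R) (t c : R) : measurable_fun setT phi ->
  (forall x, `|phi x| <= c) ->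
  (mu \x leb2)%E.-integrable setT (EFin \o rate_ff phi t).
Proof.
move=> mphi phic; have c0 : 0 <= c := le_trans (normr_ge0 _) (phic 0).
apply: (le_integrable measurableT _ _
  (integrableZl measurableT (c * (beta0 + 2)) integrable_coll)).
  apply/measurable_EFinP; apply: measurable_fun_ifT => //; first exact: measurable_window.
  apply: measurable_funM => //.
  exact: (measurableT_comp (measurable_zeta hb mphi) measurable_snd).
move=> [s [x y]] _ /=; rewrite lee_fin /rate_ff /=.
have k0 : 0 <= c * (beta0 + 2) by rewrite mulr_ge0// addr_ge0.
case: ifPn => _; last by rewrite normr0.
rewrite normrM [leRHS]normrM ler_wpM2r// [leRHS]ger0_norm//.
case: ifPn => [/andP[x0 y0]|_]; last by rewrite normr0.
exact: zeta_le_bounded.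
Qed.

Let Rintegral_eq0 (D : set R) (h : R -> R) : (forall x, D x -> h x = 0) ->
  \int[mu]_(x in D) h x = 0.
Proof.
by move=> h0; rewrite /Rintegral integral0_eq// => x Dx; rewrite h0.
Qed.

Let iterated_rate_ff (phi : R -> R) (t c : R) : 0 < t < t0 -> measurable_fun setT phi ->
  (forall x, `|phi x| <= c) ->
  \int[mu]_(s in `]0, t[) \int[mu]_(x in Rpos) \int[mu]_(y in Rpos)
     (zeta b phi x y * sum_kernel alpha beta x y * f s x * f s y) =
  fine (\int[mu \x leb2]_q (rate_ff phi t q)%:E)%E.
Proof.
move=> /andP[t_gt0 tt0] mphi phic.
rewrite -(Rintegral_iterated3 (integrable_rate_ff t mphi phic)).
rewrite Rintegral_mkcond; apply: eq_Rintegral => s _.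
rewrite /patch mem_setE in_itv/=.
case: ifPn => st; last first.
  rewrite Rintegral_eq0// => x _; apply: Rintegral_eq0 => y _.
  by rewrite /rate_ff /= (negbTE st).
rewrite Rintegral_mkcond; apply: eq_Rintegral => x _.
rewrite /patch; case: ifPn => [|]; [rewrite inE|rewrite notin_setE] => /RposE x0; last first.
  by rewrite Rintegral_eq0// => y _; rewrite /rate_ff /= (introF idP x0) st/= mul0r.
rewrite Rintegral_mkcond; apply: eq_Rintegral => y _.
rewrite /patch; case: ifPn => [|]; [rewrite inE|rewrite notin_setE] => /RposE y0; last first.
  by rewrite /rate_ff /= st (introF idP y0) x0 mul0r.
rewrite /rate_ff /= st x0 y0 /coll /patch mem_set ?mulrA//.
case/andP: st => s0 st; split; first by rewrite /= in_itv/= s0 (lt_trans st).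
by split; apply/RposE.
Qed.

Let measurable_coll_neg : measurable [set q | coll q < 0].
Proof.
have := measurable_coll measurableT (measurable_itv `]-oo, 0[).
by rewrite setTI; congr measurable; apply/seteqP; split => q /=; rewrite in_itv.
Qed.

(** For every s the product f(s,x) f(s,y) is nonnegative for almost all x and y. *)
Let coll_neg_null : (mu \x leb2)%E [set q | coll q < 0] = 0%E.
Proof.
apply: null_prod3.
  exact: measurable_coll_neg.
move=> s; have [st|st] := boolP (0 < s < t0); last first.
  apply: ae_all => x; apply: ae_all => y /=; rewrite /coll /patch ifF ?ltxx//.
  by apply/negbTE; rewrite notin_setE => -[/=]; rewrite in_itv/= (negbTE st).
have sT : itv_co T s.
  by apply: itv_oo_co; apply: before; case/andP: st => -> /ltW.
apply: ae_sub (ae_f sT) => x fx; apply: ae_sub (ae_f sT) => y fy /=.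
rewrite /coll /patch; case: ifPn => [|_]; last by rewrite ltxx.
rewrite inE => -[_ /= [/RposE x0 /RposE y0]].
by rewrite -fx// -fy// ltNge !mulr_ge0// sum_kernel_ge0.
Qed.

Let rate_FFE (phi : R -> R) (t : R) q : t < t0 ->
  rate_FF phi t q = if 0 < q.1 < t then
    (if (0 < q.2.1) && (0 < q.2.2) then zeta b phi q.2.1 q.2.2 else 0) * `|coll q|
  else 0.
Proof.
case: q => s [x y] tt0; rewrite /rate_FF /rate /=; case: ifPn => // /andP[s0 st].
rewrite -mulrA; congr (_ * _).
have [/andP[x0 y0]|xy] := boolP ((0 < x) && (0 < y)).
  rewrite /coll /patch mem_set; last first.
    by split; [rewrite /= in_itv/= s0 (lt_trans st)|split; apply/RposE].
  rewrite /abs_ext s0 (lt_trans st)//= x0 y0 !normrM mulrA.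
  by rewrite (ger0_norm (sum_kernel_ge0 _ _ _ _)).
rewrite /coll /patch ifF; last first.
  by apply/negbTE; rewrite notin_setE => -[_ /= [/RposE x0 /RposE y0]]; rewrite x0 y0 in xy.
move: xy; rewrite negb_and -!leNgt normr0 => /orP[x0|y0].
  by rewrite abs_ext_size// mul0r mulr0.
by rewrite (abs_ext_size s y0) !mulr0.
Qed.

Let measurable_rate_FF (phi : R -> R) (t : R) : measurable_fun setT phi ->
  measurable_fun setT (rate_FF phi t).
Proof.
move=> mphi.
apply: measurable_fun_ifT; [exact: measurable_window| |exact: measurable_cst].
apply: measurable_funM.
  exact: (measurableT_comp (measurable_rate alpha beta hb mphi) measurable_snd).
apply: measurable_funM.
- exact: (measurable_fun_comp2 measurable_abs_ext measurable_time measurable_size1).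
- exact: (measurable_fun_comp2 measurable_abs_ext measurable_time measurable_size2).
Qed.

Let integrable_rate_FF (phi : R -> R) (t c : R) : t < t0 -> measurable_fun setT phi ->
  (forall x, `|phi x| <= c) ->
  (mu \x leb2)%E.-integrable setT (EFin \o rate_FF phi t).
Proof.
move=> tt0 mphi phic.
apply: (le_integrable measurableT _ _ (integrable_rate_ff t mphi phic)).
  by apply/measurable_EFinP; exact: measurable_rate_FF.
move=> q _ /=; rewrite lee_fin rate_FFE// /rate_ff.
by case: ifPn => // _; rewrite !normrM normr_id.
Qed.

Let integral_rate_ff (phi : R -> R) (t c : R) : t < t0 -> measurable_fun setT phi ->
  (forall x, `|phi x| <= c) ->
  (\int[mu \x leb2]_q (rate_ff phi t q)%:E = \int[mu \x leb2]_q (rate_FF phi t q)%:E)%E.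
Proof.
move=> tt0 mphi phic; apply: ae_eq_integral => //.
- exact: measurable_int (integrable_rate_ff t mphi phic).
- exact: measurable_int (integrable_rate_FF tt0 mphi phic).
- exists [set q | coll q < 0]; split.
  + exact: measurable_coll_neg.
  + exact: coll_neg_null.
  + move=> q /= nq; apply: contrapT => cq; apply: nq => _.
    have c0 : 0 <= coll q by rewrite leNgt; apply/negP.
    by rewrite rate_FFE// /rate_ff (ger0_norm c0).
Qed.

Let window_slab (phi : R -> R) (t : R) :
  (fun q => (rate alpha beta b phi q.2 * (abs_ext q.1 q.2.1 * abs_ext q.1 q.2.2))%:E)
    \_ (`]0, t[%classic `*` setT) = EFin \o rate_FF phi t.
Proof.
apply/funext => -[s p]; rewrite /patch /rate_FF /=.
case: ifPn => [|]; [rewrite inE|rewrite notin_setE].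
  by move=> [/= + _]; rewrite in_itv/= => ->.
by move=> nD; case: ifPn => // st; case: nD; split => //=; rewrite in_itv.
Qed.

Lemma integrable_abs_rate (phi : R -> R) (t c : R) : t < t0 -> measurable_fun setT phi ->
  (forall x, `|phi x| <= c) ->
  (mu \x leb2)%E.-integrable (`]0, t[%classic `*` setT) (fun q =>
    (rate alpha beta b phi q.2 * (abs_ext q.1 q.2.1 * abs_ext q.1 q.2.2))%:E).
Proof.
move=> tt0 mphi phic.
have mD : measurable (`]0, t[%classic `*` [set: R * R]) by exact: measurableX.
apply: (@integrable_mkcond _ _ _ (mu \x leb2)%E _ _ mD).2.
by rewrite window_slab; exact: integrable_rate_FF phic.
Qed.

(** The weak formulation in terms of |f|, with the iterated integrals replaced by
    one integral over the slab. *)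
Lemma abs_balance (phi : R -> R) (t c : R) : 0 < t < t0 -> measurable_fun setT phi ->
  (forall x, `|phi x| <= c) ->
  (\int[mu]_x (phi x * (abs_ext t x - zero_ext fin x))%:E =
   2^-1%:E * \int[mu \x leb2]_(q in `]0%R, t[%classic `*` setT)
     (rate alpha beta b phi q.2 * (abs_ext q.1 q.2.1 * abs_ext q.1 q.2.2))%:E)%E.
Proof.
move=> tt0 mphi phic; have /andP[t_gt0 t_lt0] := tt0.
have tT : itv_oo T t by apply: before; rewrite t_gt0 ltW.
have Lphi : Linfty phi.
  by split; [exact: measurable_funTS|exists c; apply: ae_all => x _; exact: phic].
have := ws_eq hf tT Lphi; rewrite (iterated_rate_ff tt0 mphi phic).
rewrite (integral_rate_ff t_lt0 mphi phic) => eqn.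
have ifin := X0_integrable hfin0.
have mfin : measurable_fun Rpos fin by apply/measurable_EFinP; exact: measurable_int ifin.
have ift := integrable_f (itv_oo_co tT).
have mphiR : measurable_fun Rpos phi by exact: measurable_funTS.
have idiff : mu.-integrable Rpos (fun x => (phi x * (f t x - fin x))%:E).
  have iB : mu.-integrable Rpos (fun x => c%:E * (`|f t x|%:E + `|fin x|%:E))%E.
    apply: integrableZl => //; first exact: measurable_halfline.
    apply: integrableD; first exact: measurable_halfline.
    - exact: integrable_norm ift.
    - exact: integrable_norm ifin.
  apply: (le_integrable _ _ _ iB); first exact: measurable_halfline.
    apply/measurable_EFinP; apply: measurable_funM => //; apply: measurable_funB => //.
    exact: measurable_f (itv_oo_co tT).
  move=> x _; rewrite abse_EFin -EFinD -EFinM abse_EFin lee_fin !normrM.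
  apply: ler_pM => //; first exact: le_trans (phic x) (ler_norm _).
  by rewrite [leRHS]ger0_norm ?addr_ge0// ler_normB.
have -> : (\int[mu]_x (phi x * (abs_ext t x - zero_ext fin x))%:E =
    \int[mu]_(x in Rpos) (phi x * (f t x - fin x))%:E)%E.
  transitivity (\int[mu]_(x in Rpos) (phi x * (`|f t x| - fin x))%:E)%E.
    rewrite [RHS]integral_mkcond; apply: eq_integral => x _.
    rewrite /abs_ext /zero_ext tt0 /patch/=; case: ifPn => [x0|].
      by rewrite mem_set//; exact/RposE.
    move=> x0; rewrite subr0 mulr0; case: ifPn => //; rewrite inE => /RposE.
    by rewrite (negbTE x0).
  apply: ae_eq_integral; first exact: measurable_halfline.
  - apply/measurable_EFinP; apply: measurable_funM => //; apply: measurable_funB => //.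
    by apply: measurableT_comp => //; exact: measurable_f (itv_oo_co tT).
  - exact: measurable_int idiff.
  - by apply: ae_sub (ae_f (itv_oo_co tT)) => x fx /RposE x0; rewrite fx.
have fin_diff : (\int[mu]_(x in Rpos) (phi x * (f t x - fin x))%:E)%E \is a fin_num.
  by apply: integrable_fin_num => //; exact: measurable_halfline.
rewrite -(fineK fin_diff).
rewrite [X in X%:E](_ : _ = \int[mu]_(x in Rpos) (phi x * (f t x - fin x)))// eqn.
rewrite EFinM; congr (_ * _)%E; rewrite fineK.
  by rewrite [RHS]integral_mkcond window_slab.
have I := integrable_rate_FF t_lt0 mphi phic.
by apply: integrable_fin_num.
Qed.

End Solution.

(** * Uniqueness *)

Section Uniqueness.
Context {R : realType}.
Local Notation mu := (@lebesgue_measure R).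
Local Notation Rpos := (halfline R).
Context (alpha beta : R).
Hypotheses (halpha : 0 <= alpha) (hab : alpha <= beta) (hbeta : beta <= 1).
Context (b : R -> R -> R -> R) (beta0 : R).
Hypothesis hb : daughter_distribution b.
Hypothesis hmass : forall x y : R, 0 < x -> 0 < y ->
  (\int[mu]_(z in `]0%R, (x + y)%R[) (z * b z x y)%:E = (x + y)%:E)%E.
Hypothesis hbeta0 : 0 <= beta0.
Hypothesis hnumber : forall x y : R, 0 < x -> 0 < y ->
  (\int[mu]_(z in `]0%R, (x + y)%R[) (b z x y)%:E <= beta0%:E)%E.
Context (fin : R -> R) (T : \bar R).
Hypothesis hfin0 : X 0 fin.

Section Pair.
Context (f g : R -> R -> R).
Hypothesis hf : weak_solution (sum_kernel alpha beta) b fin T f.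
Hypothesis hMf : forall t : R, itv_oo T t ->
  mu.-integrable `]0, t[%classic (fun s => M (1 + beta) (f s)).
Hypothesis hg : weak_solution (sum_kernel alpha beta) b fin T g.
Hypothesis hMg : forall t : R, itv_oo T t ->
  mu.-integrable `]0, t[%classic (fun s => M (1 + beta) (g s)).

Let measurable_zero_ext : measurable_fun setT (zero_ext fin).
Proof.
have mfin : measurable_fun Rpos fin.
  by apply/measurable_EFinP; exact: measurable_int (X0_integrable hfin0).
have mR : measurable Rpos := measurable_halfline.
apply: (eq_measurable_fun (fin \_ Rpos)); last first.
  by apply/(measurable_restrictT _ _).1.
move=> x _; rewrite /patch /zero_ext; case: ifPn => [|].
  by rewrite inE /halfline /= in_itv/= andbT => ->.
by rewrite notin_setE /halfline /= in_itv/= andbT => /negP/negbTE->.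
Qed.

Section Horizon.
Context (t0 : R).
Hypothesis t0T : itv_oo T t0.
Local Notation F := (abs_ext f t0).
Local Notation G := (abs_ext g t0).

Let mF := measurable_abs_ext hf t0T.
Let mG := measurable_abs_ext hg t0T.

Let weighted_sum (w : R -> R) s : measurable_fun setT w -> (forall x, 0 < x -> 0 <= w x) ->
  (\int[mu]_x (w x * (F s x + G s x))%:E =
   \int[mu]_x (w x * F s x)%:E + \int[mu]_x (w x * G s x)%:E)%E.
Proof.
move=> mw w0.
have wh (h : R -> R -> R) x : 0 <= w x * abs_ext h t0 s x.
  have [x0|x0] := ltP 0 x; first by rewrite mulr_ge0 ?w0 ?abs_ext_ge0.
  by rewrite abs_ext_size// mulr0.
rewrite -ge0_integralD//.
- by apply: eq_integral => x _; rewrite -EFinD mulrDr.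
- by move=> x _; rewrite lee_fin.
- by apply/measurable_EFinP; exact: (measurable_funM mw (measurable_section s mF)).
- by move=> x _; rewrite lee_fin.
- by apply/measurable_EFinP; exact: (measurable_funM mw (measurable_section s mG)).
Qed.

Let integrable_rel (h : R -> R -> R) (phi : R -> R) (t c : R) :
  weak_solution (sum_kernel alpha beta) b fin T h -> 0 < t < t0 ->
  measurable_fun setT phi -> (forall x, `|phi x| <= c) ->
  mu.-integrable setT (fun x => (phi x * (abs_ext h t0 t x - zero_ext fin x))%:E).
Proof.
move=> hh tt0 mphi phic; have /andP[_ t_lt0] := tt0.
have mint : measurable_fun setT (fun x => phi x * (abs_ext h t0 t x - zero_ext fin x)).
  apply: measurable_funM => //; apply: measurable_funB => //.
  exact: (measurable_section t (measurable_abs_ext hh t0T)).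
apply/integrableP; split; first exact/measurable_EFinP.
rewrite (integral_fin_num_abs mu measurableT mint).
rewrite (abs_balance hb hmass hbeta0 hnumber hfin0 hh t0T tt0 mphi phic).
rewrite fin_numM//; apply: integrable_fin_num; first exact: measurableX.
exact: (integrable_abs_rate hb hmass hbeta0 hnumber hh t0T t_lt0 mphi phic).
Qed.

Let pair_balance (t c : R) (phi : R -> R) : 0 <= t < t0 ->
  measurable_fun setT phi -> (forall x, `|phi x| <= c) ->
  (\int[mu]_x (phi x * (F t x - G t x))%:E =
   4^-1%:E * \int[mu \x leb2]_(q in `]0%R, t[%classic `*` setT)
     (flux alpha beta b (fun s x => F s x + G s x)%R
        (fun s x => F s x - G s x)%R phi q)%:E)%E.
Proof.
move=> /andP[t_ge0 t_lt0] mphi phic.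
move: t_ge0; rewrite le_eqVlt => /predU1P[<-|t_gt0].
  rewrite integral0_eq; last by move=> x _; rewrite !abs_ext_time ?ltxx// subrr mulr0.
  by rewrite set_itv_ge ?bnd_simp ?ltxx// set0X integral_set0 mule0.
have tt0 : 0 < t < t0 by rewrite t_gt0.
have iF := integrable_rel hf tt0 mphi phic.
have iG := integrable_rel hg tt0 mphi phic.
have jF := integrable_abs_rate hb hmass hbeta0 hnumber hf t0T t_lt0 mphi phic.
have jG := integrable_abs_rate hb hmass hbeta0 hnumber hg t0T t_lt0 mphi phic.
have mD : measurable (`]0, t[%classic `*` [set: R * R]) by exact: measurableX.
have -> : (\int[mu]_x (phi x * (F t x - G t x))%:E =
    \int[mu]_x (phi x * (F t x - zero_ext fin x))%:E -
    \int[mu]_x (phi x * (G t x - zero_ext fin x))%:E)%E.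
  rewrite -integralB_EFin//; apply: eq_integral => x _; rewrite -EFinB; congr (_%:E).
  by ring.
rewrite (abs_balance hb hmass hbeta0 hnumber hfin0 hf t0T tt0 mphi phic).
rewrite (abs_balance hb hmass hbeta0 hnumber hfin0 hg t0T tt0 mphi phic).
have -> : (\int[mu \x leb2]_(q in `]0%R, t[%classic `*` setT)
     (flux alpha beta b (fun s x => F s x + G s x)%R
        (fun s x => F s x - G s x)%R phi q)%:E =
   2%:E * (\int[mu \x leb2]_(q in `]0%R, t[%classic `*` setT)
      (rate alpha beta b phi q.2 * (F q.1 q.2.1 * F q.1 q.2.2))%:E -
     \int[mu \x leb2]_(q in `]0%R, t[%classic `*` setT)
      (rate alpha beta b phi q.2 * (G q.1 q.2.1 * G q.1 q.2.2))%:E))%E.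
  rewrite -integralB_EFin// -integralZl//; last exact: integrableB.
  apply: eq_integral => q _; rewrite -EFinB -EFinM; congr (_%:E).
  by rewrite /flux; ring.
set I := (\int[_]_(_ in _) _)%E; set J := (\int[_]_(_ in _) _)%E.
have Ifin : I \is a fin_num by apply: integrable_fin_num.
have Jfin : J \is a fin_num by apply: integrable_fin_num.
have calc (a c' : R) :
    (2^-1%:E * a%:E - 2^-1%:E * c'%:E = 4^-1%:E * (2%:E * (a%:E - c'%:E)))%E.
  by rewrite /= -?EFinM; congr (_%:E); field.
by rewrite -(fineK Ifin) -(fineK Jfin); exact: calc.
Qed.

(** Up to a horizon t0 before T the L^1 norm is bounded, as the estimates on the
    difference require. *)
Lemma uniqueness_before (t : R) : 0 < t < t0 ->
  {ae mu, forall x, 0 < x -> `|f t x| = `|g t x|}.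
Proof.
move=> tt0.
have [CF CF0 hCF] := abs_ext_first_bound hf t0T.
have [CG CG0 hCG] := abs_ext_first_bound hg t0T.
have [BF BF0 hBF] := abs_ext_L1_bound hf t0T.
have [BG BG0 hBG] := abs_ext_L1_bound hg t0T.
have m1x : measurable_fun setT (fun x : R => 1 + x) by exact: measurable_funD.
have x10 (x : R) : 0 < x -> 0 <= 1 + x by move=> x0; rewrite addr_ge0// ltW.
have mE : measurable_fun setT (fun p : R * R => F p.1 p.2 - G p.1 p.2).
  exact: measurable_funB.
have : (\int[mu]_x ((1 + x) * `|F t x - G t x|)%:E = 0)%E.
  apply: (difference_eq0 halpha hab hbeta hb hmass hbeta0 hnumber
    (T := t0) (C := CF + CG) (S := fun s x => F s x + G s x)
    (E := fun s x => F s x - G s x)) => //.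
  - exact: addr_ge0.
  - exact: measurable_funD.
  - move=> s x; apply: (le_trans (ler_normB _ _)).
    by rewrite !ger0_norm ?abs_ext_ge0.
  - by move=> s x x0; rewrite !abs_ext_size// addr0.
  - by move=> s x st; rewrite !abs_ext_time// addr0.
  - apply: ae_sub2 hCF hCG => s hs hs'.
    by rewrite weighted_sum// EFinD leeD.
  - move=> s; apply: (@le_lt_trans _ _ (BF + BG)%:E); last exact: ltry.
    under eq_integral do rewrite -[X in X%:E]mul1r.
    rewrite weighted_sum//; under eq_integral do rewrite mul1r.
    under [X in (_ + X)%E]eq_integral do rewrite mul1r.
    by rewrite EFinD leeD.
  - under eq_integral => s _.
      rewrite weighted_sum; last 2 first.
      - exact: measurable_high_weight.
      - by move=> x _; exact: high_weight_ge0.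
      over.
    have mh (h : R -> R -> R) : weak_solution (sum_kernel alpha beta) b fin T h ->
       measurable_fun setT
         (fun s => \int[mu]_x (high_weight beta x * abs_ext h t0 s x)%:E)%E.
      move=> hh; apply: (@measurable_partial_integral _ _ _ _ _ mu
        (fun p => (high_weight beta p.2 * abs_ext h t0 p.1 p.2)%:E)).
      apply/measurable_EFinP.
      apply: (measurable_funM _ (measurable_abs_ext hh t0T)).
      exact: (measurableT_comp (measurable_high_weight beta) measurable_snd).
    have h0 (h : R -> R -> R) s :
        (0 <= \int[mu]_x (high_weight beta x * abs_ext h t0 s x)%:E)%E.
      apply: integral_ge0 => x _.
      by rewrite lee_fin mulr_ge0 ?abs_ext_ge0 ?high_weight_ge0.
    rewrite ge0_integralD//; [|exact: mh|exact: mh].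
    by apply: lte_add_pinfty;
      [exact: abs_ext_high_fin hf hMf _ t0T|exact: abs_ext_high_fin hg hMg _ t0T].
have EE : (\int[mu]_x `|((1 + x) * (F t x - G t x))%:E| =
     \int[mu]_x ((1 + x) * `|F t x - G t x|)%:E)%E.
  apply: eq_integral => x _; rewrite abse_EFin normrM; congr (_%:E).
  have [x0|x0] := ltP 0 x; first by rewrite ger0_norm// x10.
  by rewrite !abs_ext_size// subrr normr0 !mulr0.
have mint : measurable_fun setT (fun x : R => (1 + x) * (F t x - G t x)).
  exact: (measurable_funM m1x (measurable_section t mE)).
rewrite -EE => /(ae_eq0_of_integral measurableT mint); apply: ae_sub => x /(_ I).
move=> /eqP + x0; rewrite mulf_eq0 gt_eqF/=; last by rewrite addr_gt0.
by rewrite subr_eq0 /abs_ext tt0 x0/= => /eqP.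
Qed.
End Horizon.

Lemma uniqueness_positive (t : R) : itv_oo T t ->
  {ae mu, forall x, Rpos x -> f t x = g t x}.
Proof.
move=> tT; have [t_gt0 t_lt] := tT.
(* T may be infinite *)
have [t0 tt0 t0T] : exists2 t0, t < t0 & itv_oo T t0.
  have [T' [tT' T'T]] : exists T', t < T' /\ (T'%:E <= T)%E.
    move: t_lt; case: (T) => [r| |]//=; first by rewrite lte_fin => tr; exists r.
    by move=> _; exists (t + 1); rewrite ltrDl leey.
  exists ((t + T') / 2); first by rewrite midf_lt.
  split; first by rewrite divr_gt0// addr_gt0// (lt_trans t_gt0).
  by apply: lt_le_trans T'T; rewrite lte_fin midf_lt.
have fg : {ae mu, forall x, 0 < x -> `|f t x| = `|g t x|}.
  by apply: (uniqueness_before t0T); rewrite t_gt0.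
have f0 := ws_nonneg hf (itv_oo_co tT); have g0 := ws_nonneg hg (itv_oo_co tT).
have : {ae mu, forall x, Rpos x -> 0 <= f t x /\ 0 <= g t x}.
  by apply: ae_sub2 f0 g0 => x fx gx x0; split; [exact: fx|exact: gx].
apply: ae_sub2 fg => x fgx nn x0; have [fx gx] := nn x0.
rewrite -(ger0_norm fx) -(ger0_norm gx); apply: fgx.
by move: x0; rewrite /halfline /= in_itv/= andbT.
Qed.

(** Tested with the sign of f(0) - g(0), both solutions are continuous at time 0
    and agree at positive times. *)
Lemma uniqueness_initial : (0 < T)%E -> {ae mu, forall x, Rpos x -> f 0 x = g 0 x}.
Proof.
move=> T_gt0.
have T0 : itv_co T 0 by [].
have mR : measurable Rpos := measurable_halfline.
have i0 (h : R -> R -> R) : weak_solution (sum_kernel alpha beta) b fin T h ->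
    forall t, itv_co T t -> mu.-integrable Rpos (EFin \o h t).
  by move=> hh t tT; apply: X0_integrable; exact: (ws_continuous hh).1.
have mf0 : measurable_fun Rpos (f 0).
  by apply/measurable_EFinP; exact: measurable_int (i0 f hf 0 T0).
have mg0 : measurable_fun Rpos (g 0).
  by apply/measurable_EFinP; exact: measurable_int (i0 g hg 0 T0).
pose phi x := Num.sg (f 0 x - g 0 x).
have mphi : measurable_fun Rpos phi.
  apply: (measurable_comp measurableT) => //; last exact: measurable_funB.
  exact: measurable_sgr.
have phi1 x : `|phi x| <= 1 by rewrite /phi normr_sg; case: (_ != 0).
have Lphi : Linfty phi.
  by split => //; exists 1; apply: ae_all => x _; exact: phi1.
pose pair (h : R -> R -> R) t := \int[mu]_(x in Rpos) (phi x * h t x).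
have cf : {within itv_co T, continuous (pair f)} := (ws_continuous hf).2 _ Lphi.
have cg : {within itv_co T, continuous (pair g)} := (ws_continuous hg).2 _ Lphi.
have near0 : \forall t \near 0^'+, itv_oo T t.
  have [e e0 eT] : exists2 e : R, 0 < e & (e%:E <= T)%E.
    move: T_gt0; case: (T) => [r| |]//=; first by rewrite lte_fin => r0; exists r.
    by move=> _; exists 1; rewrite ?leey.
  near=> t; split; first by near: t; exact: nbhs_right_gt.
  by apply: lt_le_trans eT; rewrite lte_fin; near: t; exact: nbhs_right_lt.
have lim0 (h : R -> R -> R) : {within itv_co T, continuous (pair h)} ->
    pair h x @[x --> 0^'+] --> pair h 0.
  move=> /subspace_continuousP /(_ 0 T0); apply: cvg_trans; apply: cvg_app.
  move=> A [e /= e0 eA]; near=> t; apply: eA => /=.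
    by rewrite sub0r normrN gtr0_norm; near: t; [exact: nbhs_right_lt|exact: nbhs_right_gt].
  by apply: itv_oo_co; near: t.
have ipair (h : R -> R -> R) t : weak_solution (sum_kernel alpha beta) b fin T h ->
    itv_co T t -> mu.-integrable Rpos (EFin \o (fun x => phi x * h t x)).
  move=> hh tT; have iht := i0 h hh t tT.
  have mht : measurable_fun Rpos (h t) by apply/measurable_EFinP; exact: measurable_int iht.
  apply: (le_integrable _ _ _ iht) => //; first by apply/measurable_EFinP; exact: measurable_funM.
  by move=> x _ /=; rewrite lee_fin normrM ler_piMl.
have same : pair f 0 = pair g 0.
  apply: (@cvg_unique _ (@norm_hausdorff _ _) (pair f x @[x --> 0^'+])).
    exact: lim0 cf.
  apply: cvg_trans (lim0 g cg); apply: near_eq_cvg; near=> t.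
  have tT : itv_oo T t by near: t.
  rewrite /pair /Rintegral; congr fine; apply: ae_eq_integral => //.
  - have I := ipair g t hg (itv_oo_co tT); exact: measurable_int I.
  - have I := ipair f t hf (itv_oo_co tT); exact: measurable_int I.
  - by apply: ae_sub (uniqueness_positive tT) => x fgx x0; rewrite fgx.
have E0 : (\int[mu]_(x in Rpos) `|(f 0 x - g 0 x)%:E| = 0)%E.
  transitivity (\int[mu]_(x in Rpos) (phi x * f 0 x)%:E -
                \int[mu]_(x in Rpos) (phi x * g 0 x)%:E)%E.
    rewrite -integralB_EFin; [|exact: mR|exact: ipair|exact: ipair].
    by apply: eq_integral => x _; rewrite -EFinB -mulrBr abse_EFin normrEsg.
  have ff : (\int[mu]_(x in Rpos) (phi x * f 0 x)%:E)%E \is a fin_num.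
    by apply: integrable_fin_num => //; exact: ipair.
  have gg : (\int[mu]_(x in Rpos) (phi x * g 0 x)%:E)%E \is a fin_num.
    by apply: integrable_fin_num => //; exact: ipair.
  rewrite -(fineK ff) -(fineK gg) -/(Rintegral _ _ _) -/(Rintegral _ _ _).
  by rewrite -/(pair f 0) -/(pair g 0) same -EFinB subrr.
have mfg : measurable_fun Rpos (fun x => f 0 x - g 0 x) by exact: measurable_funB.
move: E0 => /(ae_eq0_of_integral mR mfg); apply: ae_sub => x /[apply] /eqP.
by rewrite subr_eq0 => /eqP.
Unshelve. all: by end_near. Qed.

End Pair.
End Uniqueness.

Unset Implicit Arguments.

Theorem proposition1p6 (R : realType) (alpha beta : R)
    (halpha : 0 <= alpha) (hab : alpha <= beta) (hbeta : beta <= 1)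
    (b : R -> R -> R -> R) (hb : daughter_distribution b)
    (hmass : forall x y : R, 0 < x -> 0 < y ->
      (\int[lebesgue_measure]_(z in `]0%R, (x + y)%R[) (z * b z x y)%:E
         = (x + y)%:E)%E)
    (hsupp : forall z x y : R, 0 < x -> 0 < y -> x + y < z -> b z x y = 0)
    (beta0 : R) (hbeta0 : 2 < beta0)
    (hnumber : forall x y : R, 0 < x -> 0 < y ->
      (\int[lebesgue_measure]_(z in `]0%R, (x + y)%R[) (b z x y)%:E
         <= beta0%:E)%E)
    (fin : R -> R) (hfin0 : X 0 fin) (hfin1 : Xplus 1 fin)
    (T : \bar R) (hT : (0 < T)%E)
    (f g : R -> R -> R)
    (hf : weak_solution (sum_kernel alpha beta) b fin T f)
    (hMf : forall t : R, itv_oo T t ->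
      lebesgue_measure.-integrable `]0, t[%classic
        (fun s => M (1 + beta) (f s)))
    (hg : weak_solution (sum_kernel alpha beta) b fin T g)
    (hMg : forall t : R, itv_oo T t ->
      lebesgue_measure.-integrable `]0, t[%classic
        (fun s => M (1 + beta) (g s))) :
  forall t : R, itv_co T t ->
    {ae lebesgue_measure, forall x : R, halfline R x -> f t x = g t x}.
Proof.
have beta0_ge0 : 0 <= beta0 by apply: le_trans (ltW hbeta0).
move=> t [t_ge0 tT]; move: t_ge0; rewrite le_eqVlt => /predU1P[<-|t_gt0].
- exact: (uniqueness_initial halpha hab hbeta hb hmass beta0_ge0 hnumber hfin0
    hf hMf hg hMg hT).
- exact: (uniqueness_positive halpha hab hbeta hb hmass beta0_ge0 hnumber hfin0
    hf hMf hg hMg (conj t_gt0 tT)).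
Qed.
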